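(* Let $j\in\{0,\tfrac12\}$ and let $\mathcal H_j$ be the level one irreducible unitary positive energy representation of affine $\mathfrak{sl}_2$ with lowest energy space $V_j$. For every $m\ge 0$ with $m\in j+\mathbb Z$, the action of the Virasoro algebra (by the operators $L_n$ defined in the context) on the multiplicity space $M_m$ of the irreducible $\mathfrak{sl}_2$-module $V_m$ in $\mathcal H_j$ is irreducible.
   Context: For a non-negative half-integer $i$ (i.e. $i\in\{0,\tfrac12,1,\tfrac32,\dots\}$), $V_i$ is the irreducible representation of $SU(2)$ (equivalently of $\mathfrak{sl}_2$) of dimension $2i+1$. Let $\mathfrak{sl}_2$ be the trace-zero complex $2\times2$ matrices with basis $H=\frac12(E_{11}-E_{22})$, $E=E_{12}$, $F=E_{21}$. A level one unitary positive energy representation of affine $\mathfrak{sl}_2$ is an inner product space $\mathcal H=\bigoplus_{n\ge0}\mathcal H(n)$ (algebraic orthogonal direct sum of finite-dimensional spaces) with operators $X(n)$ ($X\in\mathfrak{sl}_2$, $n\in\mathbb Z$, linear in $X$) and $D$, where $D$ acts as $n$ on $\mathcal H(n)$, $D^*=D$, $X(n)^*=X^*(-n)$, $[D,X(n)]=-nX(n)$ and $$[X(m),Y(n)]=[X,Y](m+n)+m\,\delta_{m+n,0}\,\mathrm{Tr}(XY)\,I .$$ For $j=0,\frac12$, $\mathcal H_j$ denotes the unique irreducible such representation with $\mathcal H_j(0)\cong V_j$ as a module over $\mathfrak{sl}_2$ acting by $X\mapsto X(0)$. The operators $$L_0=H(0)^2+2\sum_{n>0}H(-n)H(n),\qquad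 L_n=\sum_{p+q=n}H(p)H(q)\quad(n\neq0)$$ on $\mathcal H_j$ satisfy $L_n^*=L_{-n}$, $[L_n,X(m)]=-mX(n+m)$ and the Virasoro relations $[L_m,L_n]=(m-n)L_{m+n}+\delta_{m+n,0}\frac{m^3-m}{12}I$ (central charge $1$). In particular they commute with the action of $\mathfrak{sl}_2$ by $X(0)$, so they act on the multiplicity space of each $V_m$ in $\mathcal H_j$. This multiplicity space can be identified with $M_m=\{\xi\in\mathcal H_j: H(0)\xi=m\xi,\ E(0)\xi=0\}$. *)

(* Defs.v *)
From HB Require Import structures.
From mathcomp Require Import all_boot all_order all_algebra.
From mathcomp Require Import complex.
From mathcomp Require Import boolp classical_sets functions cardinality fsbigop.
From mathcomp Require Import reals.
Set Implicit Arguments.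
Unset Strict Implicit.
Unset Printing Implicit Defensive.
Import Order.TTheory GRing.Theory Num.Theory.

Local Open Scope classical_set_scope.
Local Open Scope ring_scope.

Section Subspaces.
Variables (K : fieldType) (V : lmodType K).
Implicit Types (W M : set V) (S : set (V -> V)).

Definition subspace W : Prop :=
  W 0 /\ forall (a : K) u v, W u -> W v -> W (a *: u + v).

Definition fin_dim W : Prop :=
  exists (d : nat) (s : 'I_d -> V),
    forall v, W v -> exists c : 'I_d -> K, v = \sum_(i < d) c i *: s i.

Definition stable S W : Prop := forall f, S f -> forall v, W v -> W (f v).

Definition irreducible_on S M : Prop :=
  [/\ subspace M, stable S M, M <> [set 0] &
      forall W, subspace W -> W `<=` M -> stable S W -> W = [set 0] \/ W = M].

End Subspaces.

Section Sl2.
Variable C : fieldType.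

Definition sl2 : set 'M[C]_2 := [set X | \tr X = 0].

Definition lie (X Y : 'M[C]_2) : 'M[C]_2 := X *m Y - Y *m X.

Definition sl2H : 'M[C]_2 := 2%:R^-1 *: (delta_mx 0 0 - delta_mx 1 1).
Definition sl2E : 'M[C]_2 := delta_mx 0 1.

Definition irr_sl2_rep (d : nat) (rho : 'M[C]_2 -> 'M[C]_d) : Prop :=
  [/\ forall a X Y, sl2 X -> sl2 Y -> rho (a *: X + Y) = a *: rho X + rho Y,
      forall X Y, sl2 X -> sl2 Y ->
        rho (lie X Y) = rho X *m rho Y - rho Y *m rho X &
      irreducible_on [set f | exists2 X, sl2 X & f = mulmx (rho X)]
        [set: 'cV[C]_d]].

End Sl2.
Arguments sl2 {C}.
Arguments sl2H {C}.
Arguments sl2E {C}.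

(* Operators X(n) are indexed by all 2x2 matrices X for convenience; only
   trace-zero X are constrained, and only those are ever used. *)
Record level1_rep (R : realType) (V : lmodType R[i]) := Level1Rep {
  inner : {dot V for Num.conj};
  grade : nat -> set V;
  op : 'M[R[i]]_2 -> int -> {linear V -> V};
  energy : {linear V -> V};
  grade_subspace : forall n, subspace (grade n);
  grade_fin_dim : forall n, fin_dim (grade n);
  grade_orthogonal : forall k n u v,
    k != n -> grade k u -> grade n v -> inner u v = 0;
  grade_span : forall v, exists (N : nat) (w : nat -> V),
    (forall n, grade n (w n)) /\ v = \sum_(n < N) w n;
  op_linear : forall a X Y n v, sl2 X -> sl2 Y ->
    op (a *: X + Y) n v = a *: op X n v + op Y n v;
  energy_grade : forall n v, grade n v -> energy v = n%:R *: v;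
  energy_adj : forall u v, inner (energy u) v = inner u (energy v);
  op_adj : forall X n u v, sl2 X ->
    inner (op X n u) v = inner u (op ((map_mx Num.conj X)^T) (- n) v);
  energy_op : forall X n v, sl2 X ->
    energy (op X n v) - op X n (energy v) = - (n%:~R *: op X n v);
  op_op : forall X Y m n v, sl2 X -> sl2 Y ->
    op X m (op Y n v) - op Y n (op X m v) =
    op (lie X Y) (m + n) v +
      (if m + n == 0 then m%:~R * \tr (X *m Y) else 0) *: v
}.

Section Level1.
Variables (R : realType) (V : lmodType R[i]) (H : level1_rep V).

Definition irreducible_rep : Prop :=
  irreducible_on
    [set f : V -> V | f = energy H \/
       exists (X : 'M[R[i]]_2) (n : int), sl2 X /\ f = op H X n]
    [set: V].

(* The lowest energy space, with X acting as X(0), is isomorphic to V_j, the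
   irreducible representation of sl2 of dimension 2j+1. *)
Definition lowest_energy_space_is (j : rat) : Prop :=
  exists (d : nat) (rho : 'M[R[i]]_2 -> 'M[R[i]]_d)
         (phi : {linear 'cV[R[i]]_d -> V}),
    [/\ d%:R = 2%:R * j + 1,
        irr_sl2_rep rho,
        injective phi,
        range phi = grade H 0%N &
        forall X x, sl2 X -> phi (rho X *m x) = op H X 0 (phi x)].

(* \sum_(i \in A) is a finitely supported sum, with value 0 if the support is
   infinite; vir_finite and vir0_finite below show that this never occurs. *)
Definition vir (n : int) (v : V) : V :=
  if n == 0 then
    op H sl2H 0 (op H sl2H 0 v) +
    2%:R *: \sum_(k \in [set k : int | 0 < k]) op H sl2H (- k) (op H sl2H k v)
  else \sum_(p \in [set: int]) op H sl2H p (op H sl2H (n - p) v).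

Definition mult_space (m : rat) : set V :=
  [set v | op H sl2H 0 v = ratr m *: v /\ op H sl2E 0 v = 0].

Lemma inner_ge0 u : 0 <= inner H u u.
Proof.
have [->|u0] := eqVneq u 0; first by rewrite linear0r.
exact/ltW/neq0_dnorm_gt0.
Qed.

Lemma energy_inner_ge0 v : 0 <= inner H (energy H v) v.
Proof.
have [N [w [gw ->]]] := grade_span H v.
rewrite [energy H _]linear_sum linear_sumlz; apply: sumr_ge0 => i _.
rewrite linear_sumr /= (bigD1 i) //= big1 => [|k ki].
  by rewrite addr0 (energy_grade (gw i)) linearZl_LR /= mulr_ge0 // inner_ge0.
rewrite (energy_grade (gw i)) linearZl_LR /=.
by rewrite (grade_orthogonal _ (gw i) (gw k)) ?mulr0 // eq_sym.
Qed.

Lemma energy_eigen_lt0 (c : R[i]) v :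
  c < 0 -> energy H v = c *: v -> v = 0.
Proof.
move=> c0 Ev; apply/eqP/negPn/negP => v0.
have := energy_inner_ge0 v; rewrite Ev linearZl_LR /=.
by rewrite nmulr_rge0 // lt_geF ?neq0_dnorm_gt0.
Qed.

Lemma op_grade_gt (X : 'M[R[i]]_2) (n : int) k v :
  sl2 X -> grade H k v -> k%:Z < n -> op H X n v = 0.
Proof.
move=> sX gv kn; apply: (@energy_eigen_lt0 (k%:Z - n)%:~R).
  by rewrite ltrz0 subr_lt0.
have /eqP := energy_op H n v sX; rewrite subr_eq => /eqP ->.
by rewrite (energy_grade gv) [op H X n (_ *: _)]linearZ intrB scalerBl addrC.
Qed.

Lemma op_eventually0 v : exists N : nat,
  forall (X : 'M[R[i]]_2) (n : int), sl2 X -> N%:Z < n -> op H X n v = 0.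
Proof.
have [N [w [gw ->]]] := grade_span H v.
exists N => X n sX Nn; rewrite linear_sum /= big1 // => i _.
apply: (op_grade_gt sX (gw i)); apply: lt_trans Nn.
by rewrite ltz_nat.
Qed.

Lemma sl2_sl2H : sl2 (sl2H : 'M[R[i]]_2).
Proof.
rewrite /sl2 /sl2H /= linearZ /= linearB /= /mxtrace !big_ord_recl !big_ord0.
by rewrite !mxE /= !addr0 add0r subrr mulr0.
Qed.

Lemma op_sl2H_comm (p q : int) v : p + q != 0 ->
  op H sl2H p (op H sl2H q v) = op H sl2H q (op H sl2H p v).
Proof.
move=> /negPf pq; have := op_op H p q v sl2_sl2H sl2_sl2H.
rewrite pq scale0r addr0 /lie subrr.
have -> : op H 0 (p + q) v = 0.
  have s0 : sl2 (0 : 'M[R[i]]_2) by rewrite /sl2 /= linear0.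
  have := op_linear H (- 1) (p + q) v s0 s0.
  by rewrite scaler0 add0r scaleN1r addNr.
by move=> /eqP; rewrite subr_eq0 => /eqP.
Qed.

Lemma finite_int_itv (a b : int) : finite_set [set p : int | a <= p <= b].
Proof.
have [ab|ba] := leP a b; last first.
  by apply: (sub_finite_set (B := set0)) => // p /= /andP[ap pb];
     have := le_trans ap pb; rewrite leNgt ba.
apply: (sub_finite_set
  (B := (fun k : nat => a + k%:Z) @` [set k | (k < `|b - a|.+1)%N])).
  move=> p /= /andP[ap pb]; exists `|p - a|%N => /=; last first.
    by rewrite gez0_abs ?subr_ge0 // subrKC.
  by rewrite ltnS -lez_nat !gez0_abs ?subr_ge0 // lerD2r.
exact/finite_image/finite_II.
Qed.

Lemma vir_finite (n : int) v : n != 0 ->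
  finite_set [set p : int | op H sl2H p (op H sl2H (n - p) v) != 0].
Proof.
move=> n0; have [N hN] := op_eventually0 v.
apply: sub_finite_set (finite_int_itv (n - N%:Z) N%:Z) => p /= pn0.
apply/andP; split; rewrite leNgt; apply: contra pn0 => hp.
  have nNp : N%:Z < n - p by rewrite ltrBrDl -ltrBrDr.
  by rewrite (hN _ _ sl2_sl2H nNp) linear0.
have np0 : p + (n - p) != 0 by rewrite subrKC.
rewrite (op_sl2H_comm _ np0).
by rewrite (hN _ _ sl2_sl2H hp) linear0.
Qed.

Lemma vir0_finite v :
  finite_set [set k : int | 0 < k /\ op H sl2H (- k) (op H sl2H k v) != 0].
Proof.
have [N hN] := op_eventually0 v.
apply: sub_finite_set (finite_int_itv 0 N%:Z) => p /= [p0 pn0].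
rewrite (ltW p0) /= leNgt; apply: contra pn0 => hp.
by rewrite (hN _ _ sl2_sl2H hp) linear0.
Qed.

End Level1.

(* Main.v *)
Require Import Defs.
From mathcomp Require Import all_boot all_order all_algebra.
From mathcomp Require Import complex zify ring lra.
From mathcomp Require Import boolp classical_sets functions cardinality fsbigop.
From mathcomp Require Import reals.
Set Implicit Arguments.
Unset Strict Implicit.
Unset Printing Implicit Defensive.
Import Order.TTheory GRing.Theory Num.Theory.
Local Open Scope classical_set_scope.
Local Open Scope ring_scope.

(** Write a_n, e_n, f_n for H(n), E(n), F(n), and call v singular if L_n v = 0
for all n > 0.

Reduction to singular vectors. A nonzero Virasoro-stable subspace W of the
multiplicity space M_m is graded, because L_0 is D up to a constant, and its
vectors of least degree are singular. The orthogonal complement of W in M_m is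
stable too, because L_n is adjoint to L_(-n). Hence M_m is irreducible as soon
as its singular vectors form a single line: this line lies in every nonzero
stable subspace, so W and its complement cannot both be nonzero
([stable_extremal], [mult_space_irreducible]).

The commutation rules. Since L_n is quadratic in the a_k, the rule
[L_n, a_k] = - k a_(n+k) is a direct computation. The rule
[L_n, e_k] = - k e_(n+k) is deeper. It says that the derivative of the current
E(z) is 2 :H(z)E(z):, and it follows from the level one relation E(z)^2 = 0 on
commuting with F(z). The relation itself ([esq_eq0]) is a null vector argument:
the first mode of E(z)^2 that does not vanish on the lowest energy space would
produce a vector killed by all positive modes in positive degree.

Extremal vectors. The formula for L_0 shows that a vector of charge q has energy
h >= q^2, with equality only if it is killed by all a_n with n > 0. The
operators e_(-2q-1) and f_(2q+1) are inverse to each other between the spaces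
of such extremal vectors of charges q and q + 1, so these spaces are lines for
all q in j + N, as they are in the lowest energy space ([extremal_line_add]).

Singular vectors. Let v be singular with charge q and energy q^2 + N.
- In the Fock space over the extremal vector w of charge q, v is determined by
  its coefficient at a_(-1)^N w: the part of L_n that raises the degree in
  a_(-1) is a_(-1) a_(n+1), up to a factor, so the part of v of top degree in
  a_(-1) involves no other mode. Hence v is unique up to scaling
  ([singular_line]).
- If v is not extremal and n is the largest index with a_n v <> 0, then the
  energy of v is ((n+1)/2)^2 ([top_mode_energy]). This is the fusion rule that
  the singular vector at level three over the state of H(z) imposes; it is
  derived here from a symmetric cubic sum of the a_k.

So the energy of v is k^2 with k in q + N. The vector f_0^(k-q) w_k, with w_k
extremal of charge k, is singular with the same charge and energy, so v is
proportional to it. If k > q then e_0 does not kill it. A singular vector in M_m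
is therefore extremal ([singular_highest]), which is the line that was
sought. *)

(** * Subspaces and finitely supported sums over the integers *)

Section Subspace.
Variables (K : fieldType) (V : lmodType K) (W : set V).
Hypothesis sW : subspace W.

Lemma subspace_0 : W 0. Proof. exact: sW.1. Qed.

Lemma subspaceZ c v : W v -> W (c *: v).
Proof. by move=> Wv; rewrite -[_ *: _]addr0; apply: sW.2 => //; exact: subspace_0. Qed.

Lemma subspaceD u v : W u -> W v -> W (u + v).
Proof. by move=> Wu Wv; rewrite -[u]scale1r; apply: sW.2. Qed.

Lemma subspaceB u v : W u -> W v -> W (u - v).
Proof. by move=> Wu Wv; apply: subspaceD => //; rewrite -scaleN1r; exact: subspaceZ. Qed.

Lemma subspace_sum (I : Type) (r : seq I) (P : pred I) (F : I -> V) :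
  (forall k, P k -> W (F k)) -> W (\sum_(k <- r | P k) F k).
Proof. by move=> h; elim/big_ind: _ => //; [exact: subspace_0|exact: subspaceD]. Qed.
End Subspace.

Notation zsum f := (\sum_(p \in [set: int]) f p).

Section IntSums.
Variables (K : numFieldType) (V : lmodType K).
Implicit Types f g : int -> V.

Definition fin_supp f := exists N : nat, forall p : int, (N < `|p|)%N -> f p = 0.

Definition zseq (N : nat) : seq int := [seq i%:Z - N%:Z | i <- iota 0 (2 * N).+1].

Lemma zseq_uniq N : uniq (zseq N).
Proof. rewrite map_inj_uniq ?iota_uniq // => i k; lia. Qed.

Lemma mem_zseq N p : (p \in zseq N) = (`|p| <= N)%N.
Proof.
apply/mapP/idP => [[k]|pN]; first by rewrite mem_iota => kN ->; lia.
exists (absz (p + N%:Z)); last by lia.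
by rewrite mem_iota; lia.
Qed.

Lemma zsum_seq (r : seq int) f : uniq r ->
  (forall p, p \notin r -> f p = 0) -> zsum f = \sum_(p <- r) f p.
Proof.
move=> ru fr; rewrite (fsbigE r) //; last by move=> p _; exact: fr.
by apply: eq_bigl => p; rewrite in_setT.
Qed.

Lemma zsumE (N : nat) f : (forall p : int, (N < `|p|)%N -> f p = 0) ->
  zsum f = \sum_(p <- zseq N) f p.
Proof.
move=> fN; apply: zsum_seq => [|p]; first exact: zseq_uniq.
by rewrite mem_zseq -ltnNge; exact: fN.
Qed.

Lemma fin_supp_common f g : fin_supp f -> fin_supp g -> exists N : nat,
  forall p : int, (N < `|p|)%N -> f p = 0 /\ g p = 0.
Proof.
move=> [N fN] [M gM]; exists (maxn N M) => p; rewrite gtn_max => /andP[? ?].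
by split; [exact: fN|exact: gM].
Qed.

Lemma zsumD f g : fin_supp f -> fin_supp g ->
  zsum (fun p => f p + g p) = zsum f + zsum g.
Proof.
move=> ff fg; have [N fgN] := fin_supp_common ff fg.
rewrite !(@zsumE N) ?big_split // => p /fgN[fp gp];
by rewrite ?fp ?gp ?addr0.
Qed.

Lemma zsum_lin (V' : lmodType K) (h : {linear V -> V'}) f :
  fin_supp f -> h (zsum f) = \sum_(p \in [set: int]) h (f p).
Proof.
move=> [N fN]; rewrite (@zsumE N) // linear_sum /=; symmetry.
rewrite (fsbigE (zseq N)) ?zseq_uniq //.
  by apply: eq_bigl => p; rewrite in_setT.
by move=> p _; rewrite mem_zseq -ltnNge => /fN /= ->; rewrite linear0.
Qed.

Lemma eq_zsum f g : f =1 g -> zsum f = zsum g.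
Proof. by move=> fg; apply: eq_fsbigr => p _. Qed.

Lemma zsum_shift (s : int) f : zsum f = zsum (fun p => f (p + s)).
Proof.
apply: (reindex_fsbigT (fun p : int => p + s)).
by exists (fun p => p - s) => p; rewrite ?addrK ?subrK.
Qed.

Lemma zsum_flip (s : int) f : zsum f = zsum (fun p => f (s - p)).
Proof.
apply: (reindex_fsbigT (fun p : int => s - p)).
by exists (fun p => s - p) => p; rewrite opprB addrC subrK.
Qed.

Lemma zsum1 (s : int) f : (forall p, p != s -> f p = 0) -> zsum f = f s.
Proof.
move=> fs; rewrite (@zsum_seq [:: s]) ?big_seq1 // => p.
by rewrite inE; exact: fs.
Qed.

(** Two divergent sums that differ by a shift: the terms need not vanish at
    positive infinity, and the limit there is what the shift contributes. *)
Lemma zsum_tele f (u : V) (N : nat) :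
    (forall p : int, (p < - N%:Z) -> f p = 0) -> (forall p : int, N%:Z < p -> f p = u) ->
  zsum (fun p => f (p + 1) - f p) = u.
Proof.
move=> f0 fu; rewrite (@zsumE N.+1) => [|p pN]; last first.
  have [p0|p0] := ltP 0 p; first by rewrite !fu ?subrr //; lia.
  by rewrite !f0 ?subrr //; lia.
rewrite big_map (eq_bigr (fun i : nat => f (i.+1%:Z - N.+1%:Z) - f (i%:Z - N.+1%:Z))).
  rewrite -{1}[(2 * _).+1]subn0 -/(index_iota _ _) telescope_sumr //.
  by rewrite fu ?f0 ?subr0 //; lia.
by move=> i _; congr (f _ - _); lia.
Qed.

Lemma fin_suppD f g :
  fin_supp f -> fin_supp g -> fin_supp (fun p => f p + g p).
Proof.
by move=> ff fg; have [N h] := fin_supp_common ff fg; exists N => p /h[-> ->]; rewrite addr0.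
Qed.

Lemma fin_suppZ (c : K) f : fin_supp f -> fin_supp (fun p => c *: f p).
Proof. by move=> [N fN]; exists N => p /fN ->; rewrite scaler0. Qed.

Lemma fin_suppN f : fin_supp f -> fin_supp (fun p => - f p).
Proof. by move=> [N fN]; exists N => p /fN ->; rewrite oppr0. Qed.

Lemma eq_fin_supp f g : f =1 g -> fin_supp f -> fin_supp g.
Proof. by move=> fg [N fN]; exists N => p /fN; rewrite fg. Qed.

Lemma fin_supp_if (P : pred int) f : fin_supp f ->
  fin_supp (fun p => if P p then f p else 0).
Proof. by move=> [N h]; exists N => p /h ->; rewrite if_same. Qed.

Lemma fin_supp_delta (r : int) f : fin_supp (fun p => if p == r then f p else 0).
Proof. by exists `|r|%N => p; case: eqP => // ->; lia. Qed.

Lemma zsumZ (c : K) f : fin_supp f -> zsum (fun p => c *: f p) = c *: zsum f.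
Proof. by move=> ff; rewrite (zsum_lin ( *:%R c)). Qed.

Lemma zsumN f : fin_supp f -> zsum (fun p => - f p) = - zsum f.
Proof.
move=> ff; rewrite -scaleN1r -zsumZ //.
by apply: eq_zsum => p; rewrite scaleN1r.
Qed.

Lemma zsum_delta (r : int) f : zsum (fun p => if p == r then f p else 0) = f r.
Proof. by rewrite (zsum1 (s := r)) ?eqxx // => p /negPf ->. Qed.

End IntSums.

(** * The Lie algebra sl2 and its current operators *)

Section Sl2Basis.
Variable K : numFieldType.
Local Notation Hm := (@sl2H K).
Local Notation Em := (@sl2E K).

Definition sl2F : 'M[K]_2 := delta_mx 1 0.
Local Notation Fm := sl2F.

Lemma ord2P (P : 'I_2 -> Prop) : P 0 -> P 1 -> forall k, P k.
Proof.
by move=> P0 P1 [[|[|//]] hk]; [move: P0|move: P1];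
  congr P; apply/val_inj.
Qed.

Lemma mx2P (A B : 'M[K]_2) : A 0 0 = B 0 0 -> A 0 1 = B 0 1 ->
  A 1 0 = B 1 0 -> A 1 1 = B 1 1 -> A = B.
Proof. by move=> *; apply/matrixP; apply: ord2P; apply: ord2P. Qed.

Lemma mulmx2E (A B : 'M[K]_2) i k : (A *m B) i k = A i 0 * B 0 k + A i 1 * B 1 k.
Proof.
by rewrite mxE !big_ord_recl big_ord0 addr0; congr (_ + _ * _); congr (_ _ _); exact/val_inj.
Qed.

Lemma tr2E (A : 'M[K]_2) : \tr A = A 0 0 + A 1 1.
Proof.
by rewrite /mxtrace !big_ord_recl big_ord0 addr0; congr (_ + _); congr (_ _ _); exact/val_inj.
Qed.

Lemma lie_HE : lie Hm Em = Em.
Proof. by apply: mx2P; rewrite mxE [X in _ + X]mxE !mulmx2E !mxE /=; field. Qed.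

Lemma lie_HF : lie Hm Fm = - Fm.
Proof. by apply: mx2P; rewrite mxE [X in _ + X]mxE !mulmx2E !mxE /=; field. Qed.

Lemma lie_EF : lie Em Fm = 2%:R *: Hm.
Proof. by apply: mx2P; rewrite mxE [X in _ + X]mxE !mulmx2E !mxE /=; field. Qed.

Lemma lie_id (X : 'M[K]_2) : lie X X = 0.
Proof. exact: subrr. Qed.

Lemma tr_HE : \tr (Hm *m Em) = 0.
Proof. by rewrite tr2E !mulmx2E !mxE /=; field. Qed.

Lemma tr_HF : \tr (Hm *m Fm) = 0.
Proof. by rewrite tr2E !mulmx2E !mxE /=; field. Qed.

Lemma tr_EF : \tr (Em *m Fm) = 1.
Proof. by rewrite tr2E !mulmx2E !mxE /=; field. Qed.

Lemma tr_EE : \tr (Em *m Em) = 0.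
Proof. by rewrite tr2E !mulmx2E !mxE /=; field. Qed.

Lemma tr_HH : \tr (Hm *m Hm) = 2%:R^-1.
Proof. by rewrite tr2E !mulmx2E !mxE /=; field. Qed.

Lemma sl2_H : sl2 Hm.
Proof. by rewrite /sl2 /= tr2E !mxE /=; field. Qed.

Lemma sl2_E : sl2 Em.
Proof. by rewrite /sl2 /= tr2E !mxE /=; field. Qed.

Lemma sl2_F : sl2 Fm.
Proof. by rewrite /sl2 /= tr2E !mxE /=; field. Qed.

Lemma sl2_0 : sl2 (0 : 'M[K]_2).
Proof. exact: linear0. Qed.

Lemma sl2_lin c (X Y : 'M[K]_2) : sl2 X -> sl2 Y -> sl2 (c *: X + Y).
Proof. by rewrite /sl2 /= => X0 Y0; rewrite linearP /= X0 Y0 mulr0 addr0. Qed.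

Lemma sl2_lie (X Y : 'M[K]_2) : sl2 (lie X Y).
Proof. by rewrite /sl2 /lie /= linearB /= mxtrace_mulC subrr. Qed.

Lemma sl2_basis X : sl2 X ->
  X = (2%:R * X 0 0) *: Hm + (X 0 1 *: Em + (X 1 0 *: Fm + 0)).
Proof.
rewrite /sl2 /= tr2E => /eqP; rewrite addrC addr_eq0 => /eqP X11.
by apply: mx2P; rewrite !mxE /= ?X11; field.
Qed.

(** Both the mode maps X |-> X(n) and a representation of sl2 are functions on
    all matrices that are linear on the trace-zero ones only. *)
Section LinearOnSl2.
Variables (W : lmodType K) (g : 'M[K]_2 -> W).
Hypothesis g_lin : forall c X Y, sl2 X -> sl2 Y -> g (c *: X + Y) = c *: g X + g Y.

Lemma sl2_linear0 : g 0 = 0.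
Proof.
by have := g_lin (- 1) sl2_0 sl2_0; rewrite scaler0 add0r scaleN1r addNr.
Qed.

Lemma sl2_linearZ c X : sl2 X -> g (c *: X) = c *: g X.
Proof. by move=> sX; have := g_lin c sX sl2_0; rewrite sl2_linear0 !addr0. Qed.

Lemma sl2_linearE X : sl2 X ->
  g X = (2%:R * X 0 0) *: g Hm + (X 0 1 *: g Em + X 1 0 *: g Fm).
Proof.
move=> sX; rewrite {1}(sl2_basis sX).
have sF : sl2 (X 1 0 *: Fm + 0) by apply: sl2_lin; [exact: sl2_F|exact: sl2_0].
have sEF : sl2 (X 0 1 *: Em + (X 1 0 *: Fm + 0)) by apply: sl2_lin => //; exact: sl2_E.
rewrite (g_lin _ sl2_H sEF) (g_lin _ sl2_E sF) (g_lin _ sl2_F sl2_0).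
by rewrite sl2_linear0 addr0.
Qed.
End LinearOnSl2.
End Sl2Basis.
Arguments sl2F {K}.

(* Unfolding the three matrices makes the comparison of two current operators
   compute matrix entries. *)
Local Opaque sl2H sl2E sl2F.

Section Currents.
Variables (R : realType) (V : lmodType R[i]) (H : level1_rep V).
Local Notation K := R[i].
Local Notation "''[' u , v ]" := (inner H u v).
Local Notation a := (op H sl2H).
Local Notation e := (op H sl2E).
Local Notation f := (op H sl2F).
Local Notation D := (energy H).

Let op_lin n v c X Y (sX : sl2 X) (sY : sl2 Y) :
  op H (c *: X + Y) n v = c *: op H X n v + op H Y n v := op_linear H c n v sX sY.

Lemma op0 n v : op H 0 n v = 0.
Proof. exact: (sl2_linear0 (op_lin n v)). Qed.

Lemma opZ c X n v : sl2 X -> op H (c *: X) n v = c *: op H X n v.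
Proof. exact: (sl2_linearZ (op_lin n v)). Qed.

Lemma opE X n v : sl2 X ->
  op H X n v = (2%:R * X 0 0) *: a n v + (X 0 1 *: e n v + X 1 0 *: f n v).
Proof. exact: (sl2_linearE (op_lin n v)). Qed.

Lemma comm_aa m n v :
  a m (a n v) = a n (a m v) + (if m + n == 0 then m%:~R / 2%:R else 0) *: v.
Proof.
have := op_op H m n v (sl2_H _) (sl2_H _); rewrite lie_id op0 add0r tr_HH.
by move/eqP; rewrite subr_eq addrC => /eqP.
Qed.

Lemma comm_ae m n v : a m (e n v) = e n (a m v) + e (m + n) v.
Proof.
have := op_op H m n v (sl2_H _) (sl2_E _); rewrite lie_HE tr_HE mulr0.
by rewrite if_same scale0r addr0 => /eqP; rewrite subr_eq addrC => /eqP.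
Qed.

Lemma comm_af m n v : a m (f n v) = f n (a m v) - f (m + n) v.
Proof.
have := op_op H m n v (sl2_H _) (sl2_F _); rewrite lie_HF tr_HF mulr0.
rewrite if_same scale0r addr0 -(scaleN1r sl2F) (opZ (- 1) (m + n) v (sl2_F _)).
by rewrite scaleN1r => /eqP; rewrite subr_eq addrC => /eqP.
Qed.

Lemma comm_ee m n v : e m (e n v) = e n (e m v).
Proof.
have := op_op H m n v (sl2_E _) (sl2_E _); rewrite lie_id op0 tr_EE mulr0.
by rewrite if_same scale0r addr0 => /eqP; rewrite subr_eq add0r => /eqP.
Qed.

Lemma comm_ef m n v : e m (f n v) =
  f n (e m v) + 2%:R *: a (m + n) v + (if m + n == 0 then m%:~R else 0) *: v.
Proof.
have := op_op H m n v (sl2_E _) (sl2_F _); rewrite lie_EF tr_EF mulr1.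
rewrite -(opZ 2%:R (m + n) v (sl2_H _)).
by move/eqP; rewrite subr_eq addrC addrA => /eqP.
Qed.

Lemma conj_tr_H : (map_mx Num.conj (sl2H : 'M[K]_2))^T = sl2H.
Proof.
apply/matrixP => -[[|[|//]] ?] [[|[|//]] ?]; rewrite !mxE /=.
- by rewrite subr0 mulr1 geC0_conj // invr_ge0 ler0n.
- by rewrite subr0 mulr0 rmorph0.
- by rewrite subr0 mulr0 rmorph0.
- by rewrite sub0r mulrN mulr1 rmorphN /= geC0_conj // invr_ge0 ler0n.
Qed.

Lemma conj_tr_E : (map_mx Num.conj (sl2E : 'M[K]_2))^T = sl2F.
Proof.
by apply/matrixP => -[[|[|//]] ?] [[|[|//]] ?]; rewrite !mxE /= ?rmorph0 ?rmorph1.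
Qed.

Lemma adj_a n u v : '[a n u, v] = '[u, a (- n) v].
Proof. by rewrite op_adj ?conj_tr_H //; exact: sl2_H. Qed.

Lemma adj_e n u v : '[e n u, v] = '[u, f (- n) v].
Proof. by rewrite op_adj ?conj_tr_E //; exact: sl2_E. Qed.

Lemma ipDl u v w : '[u + v, w] = '[u, w] + '[v, w].
Proof. exact: linearDl. Qed.

Lemma ipDr u v w : '[u, v + w] = '[u, v] + '[u, w].
Proof. exact: linearDr. Qed.

Lemma ipZl c u v : '[c *: u, v] = c * '[u, v].
Proof. exact: linearZl_LR. Qed.

Lemma ipZr c u v : '[u, c *: v] = c^* * '[u, v].
Proof. by rewrite linearZ. Qed.

Lemma ip0l u : '[0, u] = 0. Proof. exact: linear0l. Qed.

Lemma ip0r u : '[u, 0] = 0. Proof. exact: linear0r. Qed.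

Lemma ipNr u v : '[u, - v] = - '[u, v]. Proof. exact: linearNr. Qed.

Lemma ipC0 u v : '[u, v] = 0 -> '[v, u] = 0.
Proof. by move=> uv; rewrite hermC /= uv rmorph0 mulr0. Qed.

Lemma ip_eq0 u : '[u, u] = 0 -> u = 0.
Proof.
move=> uu; apply/eqP/negPn/negP => /(@neq0_dnorm_gt0 _ _ _ (inner H)).
by rewrite uu ltxx.
Qed.

Lemma ip_nondeg u : (forall w, '[w, u] = 0) -> u = 0.
Proof. by move=> /(_ u); exact: ip_eq0. Qed.

Lemma energyX X n v : sl2 X -> D (op H X n v) = op H X n (D v) - n%:~R *: op H X n v.
Proof. by move=> sX; have := energy_op H n v sX => /eqP; rewrite subr_eq addrC => /eqP. Qed.

Hypothesis Hirr : irreducible_rep H.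

(** Irreducibility as an induction principle: a linear condition that the
    energy operator and the modes of the basis of sl2 preserve holds everywhere
    as soon as it holds for one nonzero vector. *)
Lemma irr_ind (W : set V) : subspace W ->
  (forall v, W v -> W (D v)) -> (forall n v, W v -> W (a n v)) ->
  (forall n v, W v -> W (e n v)) -> (forall n v, W v -> W (f n v)) ->
  (exists2 v, v != 0 & W v) -> forall v, W v.
Proof.
move=> sW WD Wa We Wf [w w0 Ww] v; have [_ _ _] := Hirr.
move=> hW; case: (hW W sW (fun _ _ => I)) => [|W0|->//].
- move=> g [->//|[X [n [sX ->]]]] u Wu; rewrite opE //.
  apply: sW.2; first exact: Wa.
  apply: sW.2; first exact: We.
  by rewrite -[_ *: f n u]addr0; apply: sW.2; [exact: Wf|exact: sW.1].
- by move: Ww w0; rewrite W0 => /= ->; rewrite eqxx.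
Qed.

End Currents.

(** * The grading and lowest energy vectors *)

Section Grading.
Variables (R : realType) (V : lmodType R[i]) (H : level1_rep V).
Local Notation K := R[i].
Local Notation "''[' u , v ]" := (inner H u v).
Local Notation D := (energy H).

(** The polynomial in D with roots at all degrees below N other than n maps the
    vector to a nonzero multiple of its component of degree n. *)
Lemma graded_component (W : set V) (N : nat) (w : nat -> V) :
    subspace W -> (forall v, W v -> W (D v)) ->
    (forall n, grade H n (w n)) -> W (\sum_(n < N) w n) ->
  forall n, (n < N)%N -> W (w n).
Proof.
move=> sW WD gw Ww n nN.
have step (s : seq nat) :
    W (\sum_(k < N) (\prod_(l <- s) (k%:R - l%:R)) *: w k).
  elim: s => [|l s IHs].
    by under eq_bigr do rewrite big_nil scale1r.
  have := subspaceB sW (WD _ IHs) (subspaceZ sW l%:R IHs).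
  rewrite linear_sum scaler_sumr -sumrB /=; congr W; apply: eq_bigr => k _.
  rewrite linearZ /= (energy_grade (gw k)) !scalerA -scalerBl big_cons.
  by congr (_ *: _); ring.
have := step [seq l <- iota 0 N | l != n].
rewrite (bigD1 (Ordinal nN)) //= [X in _ + X]big1 => [|k kn].
  rewrite addr0; set c := \prod_(_ <- _) _ => Wc.
  have c0 : c != 0.
    rewrite /c prodf_seq_neq0; apply/allP => l; rewrite mem_filter => /andP[ln _].
    by rewrite /= subr_eq0 eqr_nat eq_sym.
  by rewrite -[w n](scalerK c0); exact: subspaceZ.
rewrite (big_rem (nat_of_ord k)) /= ?subrr ?mul0r ?scale0r //.
rewrite mem_filter mem_iota /= add0n ltn_ord andbT.
by apply: contraNneq kn => kn; apply/eqP/val_inj.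
Qed.

Lemma zero_subspace : subspace [set 0 : V].
Proof. by split=> // c u v -> ->; rewrite scaler0 addr0. Qed.

Lemma eigen_grade n v : D v = n%:R *: v -> grade H n v.
Proof.
move=> Dv; have [N [w [gw vE]]] := grade_span H v.
have gw' k : grade H k ((k%:R - n%:R : K) *: w k).
  exact: (subspaceZ (grade_subspace H k)).
have S0 : [set 0] (\sum_(k < N) (k%:R - n%:R : K) *: w k).
  under eq_bigr do rewrite scalerBl.
  rewrite sumrB -scaler_sumr -vE -Dv vE linear_sum /=.
  by apply/eqP; rewrite subr_eq0; apply/eqP/eq_bigr => k _; rewrite (energy_grade (gw k)).
have D0 v' : [set 0] v' -> [set 0] (D v') by move=> /= ->; rewrite linear0.
have w0 := graded_component zero_subspace D0 gw' S0.
rewrite vE.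
apply: (subspace_sum (grade_subspace H n)) => k _.
have [<- //|kn] := eqVneq (k : nat) n.
have /= /eqP : [set 0] ((k%:R - n%:R : K) *: w k) by exact: w0.
rewrite scaler_eq0 subr_eq0 eqr_nat (negPf kn) /= => /eqP ->.
exact: (subspace_0 (grade_subspace H n)).
Qed.

Lemma gradeP n v : grade H n v <-> D v = n%:R *: v.
Proof. by split; [exact: energy_grade|exact: eigen_grade]. Qed.

Lemma grade0_op0 X v : sl2 X -> grade H 0 v -> grade H 0 (op H X 0 v).
Proof.
move=> sX /gradeP v0; apply/gradeP.
by rewrite energyX // v0 !scale0r linear0 subrr.
Qed.

(** The subspace generated by u under the modes X(k) with k <= 0. *)
Inductive lowered (u : V) : V -> Prop :=
| lowered_gen : lowered u u
| lowered_zero : lowered u 0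
| lowered_lin c v w : lowered u v -> lowered u w -> lowered u (c *: v + w)
| lowered_op X (m : nat) v : sl2 X -> lowered u v -> lowered u (op H X (- m%:Z) v).

Lemma lowered_sub u : subspace (lowered u).
Proof. by split=> [|c v w]; [exact: lowered_zero|exact: lowered_lin]. Qed.

Hypothesis Hirr : irreducible_rep H.

(** The lowest energy space of an irreducible representation contains all
    lowest vectors: by the commutation rules the subspace that the modes X(k),
    k <= 0, generate from a lowest vector u is already stable under all modes,
    hence is everything; but if u has nonzero degree, all of it is orthogonal to
    the lowest energy space. *)
Lemma lowest_zero (c : K) u : c != 0 -> D u = c *: u ->
    (forall X (n : int), sl2 X -> 0 < n -> op H X n u = 0) ->
  (exists2 g, g != 0 & grade H 0 g) -> u = 0.
Proof.
move=> c0 Du u_low [g g0 gg]; apply: contrapT => /eqP u0.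
have sQ := lowered_sub u.
have Qop v : lowered u v -> forall X n, sl2 X -> lowered u (op H X n v).
  elim=> {v} [X n sX|X n sX|d v w _ IHv _ IHw X n sX|Y m v sY Qv IHv X n sX].
  - have [n0|n0] := ltP 0 n; first by rewrite u_low //; exact: lowered_zero.
    have -> : n = - `|n|%N%:Z by lia.
    by apply: lowered_op => //; exact: lowered_gen.
  - by rewrite linear0; exact: lowered_zero.
  - by rewrite linearP; apply: lowered_lin; [exact: IHv|exact: IHw].
  - have /eqP := op_op H n (- m%:Z) v sX sY; rewrite subr_eq => /eqP ->.
    apply: (subspaceD sQ); last by apply: lowered_op => //; exact: IHv.
    by apply: (subspaceD sQ); [apply: IHv; exact: sl2_lie|exact: (subspaceZ sQ)].
have QD v : lowered u v -> lowered u (D v).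
  elim=> {v} [||d v w _ IHv _ IHw|Y m v sY Qv IHv].
  - by rewrite Du; apply: (subspaceZ sQ); exact: lowered_gen.
  - by rewrite linear0; exact: lowered_zero.
  - by rewrite linearP; apply: lowered_lin.
  - rewrite energyX //; apply: (subspaceB sQ); first exact: lowered_op.
    by apply: (subspaceZ sQ); exact: lowered_op.
have orth v : lowered u v -> forall h, grade H 0 h -> '[v, h] = 0.
  elim=> {v} [h hg|h hg|d v w _ IHv _ IHw h hg|Y m v sY Qv IHv h hg].
  - apply: (mulfI c0); rewrite -ipZl -Du energy_adj.
    by rewrite (energy_grade hg) scale0r ip0r mulr0.
  - exact: ip0l.
  - by rewrite ipDl ipZl IHv // IHw // mulr0 addr0.
  - rewrite op_adj // opprK.
    have sY' : sl2 (map_mx Num.conj Y)^T.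
      by rewrite /sl2 /= mxtrace_tr trace_map_mx (sY : \tr Y = 0) rmorph0.
    case: m => [|m]; first by apply: IHv; exact: grade0_op0.
    by rewrite (op_grade_gt sY' hg) ?ip0r.
have [_ _ _ /(_ _ sQ (fun _ _ => I)) h] := Hirr.
case: h => [_ [->|[X [n [sX ->]]]] v Qv|Q0|QT].
- exact: QD.
- exact: Qop.
- have : [set 0] u by rewrite -Q0; exact: lowered_gen.
  by move=> /= uE; rewrite uE eqxx in u0.
- have : [set: V] g by [].
  by rewrite -QT => /orth /(_ _ gg) /ip_eq0 gE; rewrite gE eqxx in g0.
Qed.
End Grading.

(** * The level one relation E(z)^2 = 0 *)

Section SquareE.
Variables (R : realType) (V : lmodType R[i]) (H : level1_rep V).
Local Notation K := R[i].
Local Notation a := (op H sl2H).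
Local Notation e := (op H sl2E).
Local Notation f := (op H sl2F).
Local Notation D := (energy H).

Lemma op_bound v : exists N : nat, forall n : int, N%:Z < n ->
  [/\ a n v = 0, e n v = 0 & f n v = 0].
Proof.
have [N hN] := op_eventually0 H v; exists N => n Nn.
by split; apply: hN => //; [exact: sl2_H|exact: sl2_E|exact: sl2_F].
Qed.

(** The coefficients of the field E(z)^2. *)
Definition esq (s : int) (v : V) : V := zsum (fun p => e p (e (s - p) v)).

Lemma esq_supp s v : fin_supp (fun p => e p (e (s - p) v)).
Proof.
have [N hN] := op_bound v; exists (N + `|s|)%N => p pN.
have [p0|p0] := ltP 0 p.
  by rewrite comm_ee; have [|_ -> _] := hN p; [lia|rewrite linear0].
by have [|_ -> _] := hN (s - p); [lia|rewrite linear0].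
Qed.

Lemma esq_lin s c u v : esq s (c *: u + v) = c *: esq s u + esq s v.
Proof.
rewrite /esq -zsumZ; last exact: esq_supp.
rewrite -zsumD; [|apply: fin_suppZ; exact: esq_supp|exact: esq_supp].
by apply: eq_zsum => p; rewrite !linearP.
Qed.

Lemma esq_0 s : esq s 0 = 0.
Proof. by rewrite /esq fsbig1 // => p _; rewrite !linear0. Qed.

Lemma comm_e_esq n s v : e n (esq s v) = esq s (e n v).
Proof.
rewrite /esq zsum_lin; last exact: esq_supp.
by apply: eq_zsum => p /=; rewrite (comm_ee H n p) (comm_ee H n (s - p)).
Qed.

Lemma comm_a_esq n s v : a n (esq s v) = esq s (a n v) + 2%:R *: esq (n + s) v.
Proof.
rewrite /esq zsum_lin; last exact: esq_supp.
have fS : fin_supp (fun p => e (p + n) (e (n + s - (p + n)) v)).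
  have [N h] := esq_supp (n + s) v.
  by exists (N + `|n|)%N => p pN; apply: h; lia.
rewrite scaler_nat mulr2n.
rewrite -[X in _ + (X + _)]/(esq (n + s) v) [X in _ + (_ + X)](zsum_shift n).
rewrite -!zsumD //; try exact: esq_supp; last first.
  by apply: fin_suppD => //; exact: esq_supp.
apply: eq_zsum => p /=.
rewrite comm_ae comm_ae linearD /= -addrA; congr (_ + _).
congr (_ + _).
  by congr (e _ (e _ v)); lia.
by congr (e _ (e _ v)); lia.
Qed.

Lemma energy_esq s v : D (esq s v) = esq s (D v) - s%:~R *: esq s v.
Proof.
rewrite /esq zsum_lin; last exact: esq_supp.
rewrite -zsumZ; last exact: esq_supp.
rewrite -zsumN; last by apply: fin_suppZ; exact: esq_supp.
rewrite -zsumD; [|exact: esq_supp|by apply/fin_suppN/fin_suppZ; exact: esq_supp].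
apply: eq_zsum => p /=.
rewrite energyX; last exact: sl2_E.
rewrite energyX; last exact: sl2_E.
rewrite linearB linearZ /= -addrA -opprD -scalerDl -intrD.
by rewrite subrK.
Qed.

(** The commutator of f_k with the coefficients of E(z)^2 produces the two
    divergent sums of a_p e_(r-p) and of e_p a_(r-p), so they have to be combined
    term by term; the offset k between them records where they are cut. *)
Definition cross (k r : int) (v : V) : V :=
  zsum (fun p => a p (e (r - p) v) + e (p - k) (a (r + k - p) v)).

Lemma cross_supp k r v :
  fin_supp (fun p => a p (e (r - p) v) + e (p - k) (a (r + k - p) v)).
Proof.
have [N hN] := op_bound v; exists (N + `|r| + `|k|)%N => p pN.
have [p0|p0] := ltP 0 p; last first.
  have [|_ -> _] := hN (r - p); first lia.
  by have [|-> _ _] := hN (r + k - p); [lia|rewrite !linear0 addr0].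
rewrite comm_ae subrKC.
have /eqP := comm_ae H (r + k - p) (p - k) v; rewrite addrC -subr_eq => /eqP <-.
have [|-> _ _] := hN p; first lia.
have [|_ -> _] := hN (p - k); first lia.
rewrite !linear0 !add0r (_ : - p + (r + k) + (p - k) = r); last lia.
exact: subrr.
Qed.

Lemma comm_f_esq k s v : f k (esq s v) =
  esq s (f k v) + (2%:R * k%:~R) *: e (s + k) v - 2%:R *: cross k (s + k) v.
Proof.
set d1 := fun p => if p == - k then k%:~R *: e (s - p) v else 0.
set d2 := fun p => if p == s + k then k%:~R *: e p v else 0.
have dE : (2%:R * k%:~R) *: e (s + k) v = zsum d1 + zsum d2.
  rewrite /d1 /d2 (zsum_delta (- k) (fun p => k%:~R *: e (s - p) v)).
  by rewrite (zsum_delta (s + k) (fun p => k%:~R *: e p v)) opprK -scalerDl mulr_natl mulr2n.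
have fd1 : fin_supp d1 by exact: fin_supp_delta.
have fd2 : fin_supp d2 by exact: fin_supp_delta.
have fC : fin_supp (fun p => a (p + k) (e (s + k - (p + k)) v)
                   + e (p + k - k) (a (s + k + k - (p + k)) v)).
  by have [N h] := cross_supp k (s + k) v; exists (N + `|k|)%N => p pN; apply: h; lia.
rewrite /esq zsum_lin; last exact: esq_supp.
have cE : cross k (s + k) v = zsum (fun p => a (p + k) (e (s + k - (p + k)) v)
    + e (p + k - k) (a (s + k + k - (p + k)) v)) by exact: zsum_shift.
rewrite dE cE -(zsumZ 2%:R fC).
have fB := esq_supp s (f k v).
have fCN := fin_suppN (fin_suppZ 2%:R fC).
rewrite -(zsumN (fin_suppZ 2%:R fC)) -(zsumD fd1 fd2).
rewrite -(zsumD fB (fin_suppD fd1 fd2)) -(zsumD (fin_suppD fB (fin_suppD fd1 fd2)) fCN).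
apply: eq_zsum => p /=.
have fe n w : f k (e n w) = e n (f k w) - 2%:R *: a (n + k) w
    - (if n == - k then n%:~R else 0) *: w.
  by rewrite comm_ef -(addr_eq0 n k) addrAC !addrK.
rewrite fe fe !linearB !linearZ /=.
rewrite (_ : p + k - k = p); last lia.
rewrite (_ : s + k - (p + k) = s - p); last lia.
rewrite (_ : s + k + k - (p + k) = s - p + k); last lia.
rewrite opprD scalerDr.
have -> : (if s - p == - k then (s - p)%:~R else 0 : K) *: - e p v = d2 p.
  rewrite /d2 (_ : (s - p == - k) = (p == s + k)); last by apply/eqP/eqP; lia.
  case: eqP => [->|_]; last by rewrite scale0r.
  by rewrite scalerN -scaleNr -mulrNz; congr (_%:~R *: _); lia.
have -> : (if p == - k then p%:~R else 0 : K) *: - e (s - p) v = d1 p.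
  rewrite /d1; case: eqP => [->|_]; last by rewrite scale0r.
  by rewrite scalerN -scaleNr -mulrNz opprK.
by rewrite [LHS](ACl (1*(5*3)*(4*2))).
Qed.

(** For large p the term e_p a_(r-p) v is the constant - e_r v, so moving the
    cut by one step costs one such constant. *)
Lemma cross_succ k r v : cross (k + 1) r v = cross k r v + e r v.
Proof.
set t := fun p => - e (p - k - 1) (a (r + k + 1 - p) v).
have <- : zsum (fun p => t (p + 1) - t p) = e r v.
  have [N hN] := op_bound v.
  apply: (zsum_tele (N := (N + `|r| + `|k| + 1)%N)) => p hp; rewrite /t.
    by have [|-> _ _] := hN (r + k + 1 - p); [lia|rewrite linear0 oppr0].
  have /eqP := comm_ae H (r + k + 1 - p) (p - k - 1) v.
  rewrite addrC -subr_eq => /eqP <-.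
  have [|_ -> _] := hN (p - k - 1); first lia.
  by rewrite linear0 sub0r opprK; congr (e _ v); lia.
have fc := cross_supp k r v; have fc1 := cross_supp (k + 1) r v.
have tE p : a p (e (r - p) v) + e (p - (k + 1)) (a (r + (k + 1) - p) v)
  = (a p (e (r - p) v) + e (p - k) (a (r + k - p) v)) + (t (p + 1) - t p).
  have -> : t (p + 1) = - e (p - k) (a (r + k - p) v).
    by rewrite /t; congr (- e _ (a _ v)); lia.
  have -> : t p = - e (p - (k + 1)) (a (r + (k + 1) - p) v).
    by rewrite /t; congr (- e _ (a _ v)); lia.
  by rewrite opprK -[RHS]addrA addNKr.
rewrite /cross (eq_zsum tE) zsumD //.
apply: (eq_fin_supp (f := fun p =>
  (a p (e (r - p) v) + e (p - (k + 1)) (a (r + (k + 1) - p) v))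
  + - (a p (e (r - p) v) + e (p - k) (a (r + k - p) v)))).
  by move=> p; rewrite tE addrC addKr.
by apply: fin_suppD => //; exact: fin_suppN.
Qed.

Lemma int_const (T : Type) (F : int -> T) : (forall k, F (k + 1) = F k) ->
  forall k l, F k = F l.
Proof.
move=> Fs; suff F0 k : F k = F 0 by move=> k l; rewrite !F0.
case: k => n; last rewrite NegzE.
  by elim: n => // n <-; rewrite -(Fs n%:Z); congr F; lia.
elim: n => [|n <-]; first by rewrite -(Fs (- 1)) addNr.
by rewrite -(Fs (- n.+2%:Z)); congr F; lia.
Qed.

(** [f_k, E(z)^2] has no term that depends on k alone: the shift of the cut in
    [cross] compensates the central term k e_r of the affine relations. This is
    where the level matters, and it says that E(z)^2 is a null field. For large
    k the operator f_k kills any given vector, so the commutator vanishes on v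
    as soon as all coefficients of E(z)^2 kill v. *)
Lemma comm_f_esq_indep k l r v :
  f k (esq (r - k) v) - esq (r - k) (f k v) =
  f l (esq (r - l) v) - esq (r - l) (f l v).
Proof.
have E n : f n (esq (r - n) v) - esq (r - n) (f n v) =
    (2%:R * n%:~R) *: e r v - 2%:R *: cross n r v.
  by rewrite comm_f_esq subrK [LHS](ACl (1*4*(2*3))) /= subrr add0r.
rewrite !E; apply: (int_const (F := fun n =>
  (2%:R * n%:~R : K) *: e r v - 2%:R *: cross n r v)) => n.
rewrite cross_succ scalerDr intrD mulrDr mulr1 scalerDl opprD.
by rewrite [LHS](AC (2*2) (1*3*(2*4))) /= subrr addr0.
Qed.

Hypothesis Hirr : irreducible_rep H.
Hypothesis g_neq0 : exists2 g, g != 0 & grade H 0 g.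
Hypothesis e0sq : forall g, grade H 0 g -> e 0 (e 0 g) = 0.

(** By downward induction on s, the vector esq s g is killed by all positive
    modes, and it has degree - s, so it vanishes when s < 0. For s = 0 the only
    term left is e_0^2 g; it vanishes because the lowest energy space is V_0 or
    V_(1/2), which is what the last hypothesis of the section records. *)
Lemma esq_grade0 s g : grade H 0 g -> esq s g = 0.
Proof.
have pos n h X : grade H 0 h -> 0 < n -> sl2 X -> op H X n h = 0.
  by move=> gh n0 sX; exact: (op_grade_gt sX gh).
have Bpos t h : 0 <= t -> grade H 0 h -> esq t h = 0.
  move=> t0 gh; apply: fsbig1 => p _.
  have [p0|p0] := ltP 0 p.
    by rewrite comm_ee (pos p) ?linear0 //; exact: sl2_E.
  have [tp|tp] := ltP 0 (t - p).
    by rewrite (pos (t - p)) ?linear0 //; exact: sl2_E.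
  have [-> ->] : p = 0 /\ t = 0 by lia.
  by rewrite subr0 e0sq.
have [s0|s0] := leP 0 s; first exact: Bpos.
have -> : s = - `|s|%N%:Z by lia.
elim/ltn_ind: `|s|%N g => {s s0} n IHn g gg.
case: n IHn => [|n] IHn; first exact: Bpos.
have IH t : - n.+1%:Z < t -> forall h, grade H 0 h -> esq t h = 0.
  move=> tn h gh; have [t0|t0] := leP 0 t; first exact: Bpos.
  have -> : t = - `|t|%N%:Z by lia.
  by apply: IHn => //; lia.
apply: (lowest_zero Hirr (c := n.+1%:R)) => //.
- by rewrite pnatr_eq0.
- rewrite energy_esq (energy_grade gg) scale0r esq_0 sub0r -scaleNr -mulrNz opprK.
  by [].
move=> X k sX k0; rewrite opE //.
have -> : a k (esq (- n.+1%:Z) g) = 0.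
  rewrite comm_a_esq (pos k) ?esq_0 //; last exact: sl2_H.
  by rewrite IH ?scaler0 ?addr0 //; lia.
have -> : e k (esq (- n.+1%:Z) g) = 0.
  by rewrite comm_e_esq (pos k) ?esq_0 //; exact: sl2_E.
have -> : f k (esq (- n.+1%:Z) g) = 0.
  have := comm_f_esq_indep k 0 (k - n.+1%:Z) g.
  rewrite (_ : k - n.+1%:Z - k = - n.+1%:Z); last lia.
  rewrite (pos k g) ?esq_0 //; last exact: sl2_F.
  rewrite !subr0 => ->; rewrite !IH ?linear0 ?addr0 //; try lia.
  by apply: grade0_op0 => //; exact: sl2_F.
by rewrite !scaler0 !addr0.
Qed.

(** The vectors that all coefficients of E(z)^2 kill form a subrepresentation. *)
Lemma esq_eq0 s v : esq s v = 0.
Proof.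
suff h : forall w, [set w | forall t, esq t w = 0] w by exact: (h v s).
apply: (irr_ind Hirr) => [|w Bw t|n w Bw t|n w Bw t|n w Bw t|].
- split=> [t|c w1 w2 B1 B2 t] /=; first exact: esq_0.
  by rewrite esq_lin B1 B2 scaler0 addr0.
- by have := energy_esq t w; rewrite Bw linear0 scaler0 subr0 => <-.
- by have := comm_a_esq n t w; rewrite !Bw linear0 scaler0 addr0 => <-.
- by rewrite -comm_e_esq Bw linear0.
- have [N hN] := op_bound w.
  have := comm_f_esq_indep n N.+1%:Z (t + n) w.
  have [|_ _ ->] := hN N.+1%:Z; first by lia.
  rewrite addrK !Bw !linear0 esq_0 subrr sub0r => /eqP.
  by rewrite oppr_eq0 => /eqP.
- by have [g g0 gg] := g_neq0; exists g => // t; exact: esq_grade0.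
Qed.
End SquareE.

(** * Commutation rules of the Virasoro operators *)

Section Virasoro.
Variables (R : realType) (V : lmodType R[i]) (H : level1_rep V).
Local Notation K := R[i].
Local Notation "''[' u , v ]" := (inner H u v).
Local Notation a := (op H sl2H).
Local Notation e := (op H sl2E).
Local Notation f := (op H sl2F).
Local Notation D := (energy H).
Local Notation L := (vir H).

(** [nprod p q] is the normal ordered product of a_p and a_q, and [nconst p q] is
    the constant by which it differs from the plain product. *)
Definition nconst (p q : int) : K := if (p + q == 0) && (0 < p) then p%:~R / 2%:R else 0.
Definition nprod (p q : int) (v : V) : V := a p (a q v) - nconst p q *: v.

Lemma nprod_lin p q c u v : nprod p q (c *: u + v) = c *: nprod p q u + nprod p q v.
Proof.
rewrite /nprod (linearP (a q)) (linearP (a p)) /= scalerDr opprD scalerBr !scalerA.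
by rewrite (mulrC c) [LHS]addrACA.
Qed.

Lemma nprod_neq p q v : p + q != 0 -> nprod p q v = a p (a q v).
Proof. by move=> /negPf pq; rewrite /nprod /nconst pq scale0r subr0. Qed.

Lemma nprod_opp (p : int) v : nprod p (- p) v = a (- `|p|) (a `|p| v).
Proof.
have [p0|p0] := ltP 0 p.
  by rewrite /nprod /nconst subrr eqxx p0 gtr0_norm // comm_aa subrr eqxx addrK.
by rewrite /nprod /nconst [0 < p]ltNge p0 andbF scale0r subr0 ler0_norm // opprK.
Qed.

Lemma nprod_supp (N : nat) n v : (forall k : int, N%:Z < k -> a k v = 0) ->
  forall p : int, (N + `|n| < `|p|)%N -> nprod p (n - p) v = 0.
Proof.
move=> hN p pN; have [n0|n0] := eqVneq n 0.
  by rewrite n0 add0r nprod_opp hN ?linear0 //; lia.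
have pq : p + (n - p) != 0 by rewrite subrKC.
rewrite nprod_neq //; have [p0|p0] := ltP 0 p.
  by rewrite op_sl2H_comm // hN ?linear0 //; lia.
by rewrite hN ?linear0 //; lia.
Qed.

Lemma nprod_fin_supp n v : fin_supp (fun p => nprod p (n - p) v).
Proof.
have [N hN] := op_bound H v; exists (N + `|n|)%N; apply: nprod_supp => k kN.
by have [] := hN k.
Qed.

Lemma vir_zsum n v : L n v = zsum (fun p => nprod p (n - p) v).
Proof.
rewrite /vir; case: eqP => [->|/eqP n0]; last first.
  by apply: eq_zsum => p; rewrite nprod_neq // subrKC.
set F := fun p => nprod p (0 - p) v; have fF : fin_supp F by exact: nprod_fin_supp.
set F1 := fun p => if p == 0 then F p else 0.
set F2 := fun p => if 0 < p then F p else 0.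
set F3 := fun p => if p < 0 then F p else 0.
have -> : zsum F = zsum F1 + (zsum F2 + zsum F3).
  rewrite -!zsumD; try exact: fin_supp_if; last first.
    by apply: fin_suppD; exact: fin_supp_if.
  by apply: eq_zsum => p; rewrite /F1 /F2 /F3; case: ltgtP; rewrite ?addr0 ?add0r.
have -> : zsum F1 = a 0 (a 0 v).
  by rewrite (zsum_delta 0 F) /F subrr -{2}oppr0 nprod_opp normr0 oppr0.
congr (_ + _); have -> : zsum F3 = zsum F2.
  rewrite (zsum_flip 0); apply: eq_zsum => p; rewrite /F2 /F3 /F !sub0r opprK.
  rewrite oppr_lt0; case: ifP => // p0.
  by have := nprod_opp (- p) v; rewrite normrN opprK nprod_opp.
rewrite -[RHS]mulr2n -[RHS]scaler_nat; congr (_ *: _).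
rewrite fsbig_mkcond; apply: eq_zsum => p.
rewrite /patch /F2 /F sub0r; case: ifPn; rewrite ?in_setE.
  by move=> /= p0; rewrite p0 nprod_opp gtr0_norm.
by move/negP; rewrite in_setE /= => /negP/negPf ->.
Qed.

Lemma vir_lin n c u v : L n (c *: u + v) = c *: L n u + L n v.
Proof.
rewrite !vir_zsum -zsumZ; last exact: nprod_fin_supp.
rewrite -zsumD; [|by apply: fin_suppZ; exact: nprod_fin_supp|exact: nprod_fin_supp].
by apply: eq_zsum => p; rewrite nprod_lin.
Qed.

Lemma vir_0 n : L n 0 = 0.
Proof. by have := vir_lin n (-1) 0 0; rewrite scaler0 add0r scaleN1r addNr. Qed.

Lemma virZ n c v : L n (c *: v) = c *: L n v.
Proof. by have := vir_lin n c v 0; rewrite vir_0 !addr0. Qed.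

Lemma comm_aL m n v : a m (L n v) = L n (a m v) + m%:~R *: a (n + m) v.
Proof.
set c : K := m%:~R / 2%:R.
set d1 := fun p => if p == n + m then c *: a p v else 0.
set d2 := fun p => if p == - m then c *: a (n - p) v else 0.
have fd1 : fin_supp d1 by exact: fin_supp_delta.
have fd2 : fin_supp d2 by exact: fin_supp_delta.
have -> : m%:~R *: a (n + m) v = zsum d1 + zsum d2.
  rewrite (zsum_delta (n + m) (fun p => c *: a p v)).
  rewrite (zsum_delta (- m) (fun p => c *: a (n - p) v)) opprK -scalerDl.
  by congr (_ *: _); rewrite /c; field.
have f1 := nprod_fin_supp n v; have f2 := nprod_fin_supp n (a m v).
rewrite !vir_zsum zsum_lin // -(zsumD fd1 fd2) -(zsumD f2 (fin_suppD fd1 fd2)).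
apply: eq_zsum => p /=; rewrite /nprod linearB linearZ /= -scalerN.
rewrite (comm_aa H m p) (comm_aa H m (n - p)) linearD linearZ /=.
have -> : (if m + (n - p) == 0 then m%:~R / 2%:R else 0 : K) *: a p v = d1 p.
  rewrite /d1 (_ : (m + (n - p) == 0) = (p == n + m)); last by apply/eqP/eqP; lia.
  by case: ifP; rewrite ?scale0r.
have -> : (if m + p == 0 then m%:~R / 2%:R else 0 : K) *: a (n - p) v = d2 p.
  rewrite /d2 (_ : (m + p == 0) = (p == - m)); last by apply/eqP/eqP; lia.
  by case: ifP; rewrite ?scale0r.
by rewrite scalerN [LHS](ACl (1*4*(2*3))).
Qed.

Lemma energy_vir n v : D (L n v) = L n (D v) - n%:~R *: L n v.
Proof.
have f1 := nprod_fin_supp n v; have f2 := nprod_fin_supp n (D v).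
rewrite !vir_zsum zsum_lin // -(zsumZ _ f1) -(zsumN (fin_suppZ _ f1)).
rewrite -(zsumD f2 (fin_suppN (fin_suppZ _ f1))).
apply: eq_zsum => p /=; rewrite /nprod linearB linearZ /=.
rewrite (energyX H p _ (sl2_H _)) (energyX H (n - p) _ (sl2_H _)) linearB linearZ /=.
have nc : n%:~R * nconst p (n - p) = 0.
  by rewrite /nconst subrKC; case: eqP => [->|]; rewrite ?mul0r ?mulr0.
rewrite scalerBr scalerA nc scale0r subr0.
have -> : n%:~R *: a p (a (n - p) v) =
   p%:~R *: a p (a (n - p) v) + (n - p)%:~R *: a p (a (n - p) v).
  by rewrite -scalerDl -intrD subrKC.
by rewrite opprD [RHS](AC (2*2) (1*4*3*2)).
Qed.

Lemma adj_L n u v : '[L n u, v] = '[u, L (- n) v].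
Proof.
have [N1 h1] := nprod_fin_supp n u; have [N2 h2] := nprod_fin_supp (- n) v.
pose G p := nprod (p - n) (- n - (p - n)) v.
have -> : L (- n) v = zsum G by rewrite vir_zsum; exact: zsum_shift.
rewrite vir_zsum.
set N := (N1 + N2 + `|n|)%N.
rewrite (@zsumE _ _ N) => [|p pN]; last by apply: h1; rewrite /N in pN; lia.
rewrite (@zsumE _ _ N) => [|p pN]; last by apply: h2; rewrite /N in pN; lia.
rewrite linear_sumlz linear_sumr; apply: eq_bigr => p _ /=.
rewrite /G (_ : - n - (p - n) = - p); last lia.
rewrite /nprod linearBl linearBr /= ipZl ipZr !adj_a.
rewrite (_ : - (n - p) = p - n); last lia.
congr (_ - _ * _); rewrite /nconst.
rewrite (_ : (p - n + - p == 0) = (n == 0)); last by apply/eqP/eqP; lia.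
rewrite (_ : (p + (n - p) == 0) = (n == 0)); last by apply/eqP/eqP; lia.
case: eqP => [->|] /=; last by rewrite rmorph0.
rewrite subr0; case: ifP => [p0|]; last by rewrite rmorph0.
by rewrite geC0_conj // divr_ge0 ?ler0n // ler0z ltW.
Qed.

Hypothesis Hirr : irreducible_rep H.
Hypothesis g_neq0 : exists2 g, g != 0 & grade H 0 g.
Hypothesis e0sq : forall g, grade H 0 g -> e 0 (e 0 g) = 0.

(** The commutator of L_n with e_m is the cross term in the commutator of
    f_(-m) with the coefficient n + 2m of E(z)^2, which vanishes. *)
Lemma comm_eL m n v : e m (L n v) = L n (e m v) + m%:~R *: e (n + m) v.
Proof.
have C : cross H (- m) (n + m) v = - (m%:~R *: e (n + m) v).
  have := comm_f_esq H (- m) (n + m + m) v.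
  rewrite !(esq_eq0 Hirr g_neq0 e0sq) linear0 add0r addrK.
  move=> /esym/eqP; rewrite -scalerA -scalerBr scaler_eq0 pnatr_eq0 /=.
  by rewrite subr_eq0 mulrNz scaleNr => /eqP.
have f1 := nprod_fin_supp n v; have f2 := nprod_fin_supp n (e m v).
have f3 := cross_supp H (- m) (n + m) v.
rewrite -[_ *: _]opprK -C /cross !vir_zsum zsum_lin // -zsumN //.
rewrite -(zsumD f2 (fin_suppN f3)); apply: eq_zsum => p /=.
rewrite /nprod linearB linearZ /=.
rewrite (comm_ae H (n - p) m) linearD (comm_ae H p m) opprK /=.
rewrite (_ : n - p + m = n + m - p); last lia.
rewrite (_ : n + m - m - p = n - p); last lia.
by rewrite opprD [RHS](AC (4*2) (1*4*(2*6)*(3*5))) /= !subrr !addr0.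
Qed.

Lemma comm_fL m n v : f m (L n v) = L n (f m v) + m%:~R *: f (n + m) v.
Proof.
apply/eqP; rewrite -subr_eq0; apply/eqP/(ip_nondeg (H := H)) => w.
have E : '[w, f m (L n v)] = '[w, L n (f m v)] + m%:~R * '[w, f (n + m) v].
  have adjE k x y : '[x, f k y] = '[e (- k) x, y] by rewrite adj_e opprK.
  have adjL k x y : '[x, L k y] = '[L (- k) x, y] by rewrite adj_L opprK.
  rewrite !adjE !adjL adjE (comm_eL (- m) (- n)) ipDl ipZl.
  by rewrite opprD mulrNz mulNr subrK.
rewrite ipDr ipNr ipDr ipZr E.
by rewrite rmorph_int subrr.
Qed.

(** L_0 - D commutes with all modes, so it is a scalar. *)
Lemma vir0_energy (c : K) : (exists2 g, g != 0 & grade H 0 g /\ L 0 g = c *: g) ->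
  forall v, L 0 v = D v + c *: v.
Proof.
move=> [g g0 [gg Lg]] v.
suff h : forall w, [set w | L 0 w = D w + c *: w] w by exact: h.
apply: (irr_ind Hirr) => [|w Ww|n w Ww|n w Ww|n w Ww|] /=.
- split=> [|d w1 w2 /= h1 h2] /=; first by rewrite vir_0 linear0 scaler0 addr0.
  rewrite vir_lin h1 h2 linearP /= !scalerDr !scalerA [c * d]mulrC.
  by rewrite addrACA.
- by have := energy_vir 0 w; rewrite scale0r subr0 => <-; rewrite Ww linearD linearZ.
- have /eqP := comm_aL n 0 w; rewrite -subr_eq add0r => /eqP <-.
  by rewrite Ww linearD linearZ /= addrAC energyX //; exact: sl2_H.
- have /eqP := comm_eL n 0 w; rewrite -subr_eq add0r => /eqP <-.
  by rewrite Ww linearD linearZ /= addrAC energyX //; exact: sl2_E.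
- have /eqP := comm_fL n 0 w; rewrite -subr_eq add0r => /eqP <-.
  by rewrite Ww linearD linearZ /= addrAC energyX //; exact: sl2_F.
- by exists g => //; rewrite Lg (energy_grade gg) scale0r add0r.
Qed.
End Virasoro.

(** * Charge, energy and extremal vectors *)

Section States.
Variables (R : realType) (V : lmodType R[i]) (H : level1_rep V).
Local Notation K := R[i].
Local Notation "''[' u , v ]" := (inner H u v).
Local Notation a := (op H sl2H).
Local Notation e := (op H sl2E).
Local Notation f := (op H sl2F).
Local Notation D := (energy H).
Local Notation L := (vir H).

Definition state (q h : K) (v : V) := a 0 v = q *: v /\ L 0 v = h *: v.

Lemma state_lin q h c u v : state q h u -> state q h v -> state q h (c *: u + v).
Proof.
move=> [u1 u2] [v1 v2]; split.
  by rewrite linearP u1 v1 scalerDr !scalerA mulrC.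
by rewrite vir_lin u2 v2 scalerDr !scalerA mulrC.
Qed.

Lemma state_a q h n v : state q h v -> state q (h - n%:~R) (a n v).
Proof.
move=> [v1 v2]; split.
  rewrite comm_aa v1 linearZ /= mul0r if_same scale0r addr0 //.
have /eqP := comm_aL H n 0 v; rewrite add0r -subr_eq => /eqP <-.
by rewrite v2 linearZ -scalerBl.
Qed.

(** L_0 is H(0)^2 plus a sum of the positive operators a_p^* a_p. *)
Lemma state_norm q h v : state q h v -> exists N : nat,
  (forall k : int, N%:Z < k -> a k v = 0) /\
  (h - q ^+ 2) * '[v, v] = \sum_(p <- zseq N | p != 0) '[a `|p| v, a `|p| v].
Proof.
move=> [v1 v2]; have [N hN] := op_bound H v.
have aN k : N%:Z < k -> a k v = 0 by move=> /hN[].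
exists N; split=> //.
have : '[L 0 v, v] = h * '[v, v] by rewrite v2 ipZl.
rewrite vir_zsum (@zsumE _ _ N); last first.
  by move=> p pN; apply: (nprod_supp aN); lia.
rewrite linear_sumlz (bigD1_seq 0) ?zseq_uniq ?mem_zseq //=.
rewrite subrr -{2}oppr0 nprod_opp normr0 oppr0 v1 linearZ /= v1 scalerA ipZl => E.
rewrite mulrBl -E expr2 addrAC subrr add0r; apply: eq_bigr => p _.
by rewrite sub0r nprod_opp adj_a opprK.
Qed.

Lemma mode_norms_ge0 N v : 0 <= \sum_(p <- zseq N | p != 0) '[a `|p| v, a `|p| v].
Proof. by apply: sumr_ge0 => p _; exact: inner_ge0. Qed.

Lemma state_bound q h v : state q h v -> v != 0 -> 0 <= h - q ^+ 2.
Proof.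
move=> sv v0; have [N [_ E]] := state_norm sv.
have vv : 0 < '[v, v] by exact: neq0_dnorm_gt0.
by rewrite -(pmulr_lge0 _ vv) E mode_norms_ge0.
Qed.

Lemma state_eq0 q h v : state q h v -> h - q ^+ 2 < 0 -> v = 0.
Proof.
move=> sv lt; apply/eqP/negPn/negP => v0.
by have := lt_le_trans lt (state_bound sv v0); rewrite ltxx.
Qed.

Lemma state_vacuum q v n : state q (q ^+ 2) v -> 0 < n -> a n v = 0.
Proof.
move=> sv n0; have [N [aN]] := state_norm sv.
rewrite subrr mul0r => /esym/eqP.
rewrite psumr_eq0 => [/allP h|p _]; last exact: inner_ge0.
have [nN|/aN//] := leP n N%:Z.
have := h n; rewrite mem_zseq => /(_ _)/implyP hn.
apply: ip_eq0; apply/eqP; have := hn _ _.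
by rewrite gtr0_norm //; apply; [lia|rewrite gt_eqF].
Qed.

Lemma vacuum_energy q h v : state q h v -> (forall n : int, 0 < n -> a n v = 0) -> v != 0 ->
  h = q ^+ 2.
Proof.
move=> sv vac v0; have [N [_ E]] := state_norm sv.
apply/eqP; rewrite -subr_eq0; have /eqP : (h - q ^+ 2) * '[v, v] = 0.
  by rewrite E big1 // => p p0; rewrite vac ?normr_gt0 // ip0l.
have vv : '[v, v] != 0 by rewrite gt_eqF //; exact: neq0_dnorm_gt0.
by rewrite mulf_eq0 (negPf vv) orbF => /eqP ->.
Qed.

Hypothesis Hirr : irreducible_rep H.
Hypothesis g_neq0 : exists2 g, g != 0 & grade H 0 g.
Hypothesis e0sq : forall g, grade H 0 g -> e 0 (e 0 g) = 0.

Lemma state_e q h n v : state q h v -> state (q + 1) (h - n%:~R) (e n v).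
Proof.
move=> [v1 v2]; split.
  by rewrite comm_ae v1 linearZ /= add0r scalerDl scale1r.
have /eqP := comm_eL Hirr g_neq0 e0sq n 0 v; rewrite add0r -subr_eq => /eqP <-.
by rewrite v2 linearZ -scalerBl.
Qed.

Lemma state_f q h n v : state q h v -> state (q - 1) (h - n%:~R) (f n v).
Proof.
move=> [v1 v2]; split.
  by rewrite comm_af v1 linearZ /= add0r scalerBl scale1r.
have /eqP := comm_fL Hirr g_neq0 e0sq n 0 v; rewrite add0r -subr_eq => /eqP <-.
by rewrite v2 linearZ -scalerBl.
Qed.

(** Charges are half-integers, so they are indexed by their doubles. *)
Definition charge (z : nat) : K := z%:R / 2%:R.
Definition extremal (z : nat) (v : V) := state (charge z) (charge z ^+ 2) v.

(** With q = z / 2, both e_(-z-1) and f_(z+1) move between the least possible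
    energies q^2 and (q + 1)^2. Their products reduce to the commutator, which
    is the scalar 1, because f_(z+1) maps charge q to charge q - 1 with energy
    below the bound (q - 1)^2. *)
Lemma extremal_up z v : extremal z v ->
  extremal z.+2 (e (- z.+1%:Z) v) /\ f z.+1%:Z (e (- z.+1%:Z) v) = v.
Proof.
move=> ev; split.
  have := state_e (- z.+1%:Z) ev; congr (state _ _ _).
    by rewrite /charge -[z.+2]addn2 natrD; field.
  by rewrite /charge mulrNz -pmulrn -[z.+2]addn2 natrD -natr1; field.
have fv0 : f z.+1%:Z v = 0.
  apply: (state_eq0 (state_f z.+1%:Z ev)).
  have -> : charge z ^+ 2 - z.+1%:Z%:~R - (charge z - 1) ^+ 2 = - 2%:R.
    by rewrite /charge -pmulrn -natr1; field.
  by rewrite oppr_lt0 ltr0n.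
have := comm_ef H (- z.+1%:Z) z.+1%:Z v; rewrite fv0 linear0 addNr eqxx.
rewrite ev.1 scalerA -addrA -scalerDl => /esym/eqP; rewrite addr_eq0 => /eqP ->.
rewrite -scaleNr -[RHS]scale1r; congr (_ *: _).
by rewrite /charge mulrNz -pmulrn -natr1; field.
Qed.

Lemma extremal_down z v : extremal z.+2 v ->
  extremal z (f z.+1%:Z v) /\ e (- z.+1%:Z) (f z.+1%:Z v) = v.
Proof.
move=> ev; split.
  have := state_f z.+1%:Z ev; congr (state _ _ _).
    by rewrite /charge -[z.+2]addn2 natrD; field.
  by rewrite /charge -pmulrn -[z.+2]addn2 natrD -natr1; field.
have ev0 : e (- z.+1%:Z) v = 0.
  apply: (state_eq0 (state_e (- z.+1%:Z) ev)).
  have -> : charge z.+2 ^+ 2 - (- z.+1%:Z)%:~R - (charge z.+2 + 1) ^+ 2 = - 2%:R.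
    by rewrite /charge mulrNz -pmulrn -[z.+2]addn2 natrD -natr1; field.
  by rewrite oppr_lt0 ltr0n.
rewrite comm_ef ev0 linear0 add0r addNr eqxx ev.1 scalerA -scalerDl -[RHS]scale1r.
congr (_ *: _).
by rewrite /charge mulrNz -pmulrn -[z.+2]addn2 natrD -natr1; field.
Qed.

Definition extremal_line (z : nat) := exists2 w, w != 0 &
  extremal z w /\ forall v, extremal z v -> exists c : K, v = c *: w.

Lemma extremal_lineS z : extremal_line z -> extremal_line z.+2.
Proof.
move=> [w w0 [ew wu]]; have [eu fu] := extremal_up ew.
exists (e (- z.+1%:Z) w).
  by apply: contraNneq w0 => u0; rewrite -fu u0 linear0.
split=> // v /extremal_down[efv ev].
have [c fv] := wu _ efv; exists c.
by rewrite -ev fv linearZ.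
Qed.

Lemma extremal_line_add J r : extremal_line J -> extremal_line (J + r.*2).
Proof. by move=> h; elim: r => [|r IHr]; rewrite ?addn0 // doubleS !addnS; exact: extremal_lineS. Qed.

Definition singular (v : V) := forall n : int, 0 < n -> L n v = 0.

Lemma comm_e0L n v : e 0 (L n v) = L n (e 0 v).
Proof. by rewrite (comm_eL Hirr g_neq0 e0sq) scale0r addr0. Qed.
Lemma comm_f0L n v : f 0 (L n v) = L n (f 0 v).
Proof. by rewrite (comm_fL Hirr g_neq0 e0sq) scale0r addr0. Qed.

Lemma extremal_singular z v : extremal z v -> singular v.
Proof.
move=> ev n n0; rewrite vir_zsum; apply: fsbig1 => p _.
rewrite nprod_neq ?subrKC ?gt_eqF //.
have [p0|p0] := ltP 0 p; last by rewrite (state_vacuum ev) ?linear0 //; lia.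
by rewrite op_sl2H_comm ?subrKC ?gt_eqF // (state_vacuum ev) ?linear0.
Qed.

Lemma singular_f0 v : singular v -> singular (f 0 v).
Proof. by move=> sv n n0; rewrite -comm_f0L sv // linear0. Qed.

Lemma nconst_diff p q : nconst R p q - nconst R q p = (if p + q == 0 then p%:~R / 2%:R else 0 : K).
Proof.
rewrite /nconst (addrC q p); case: eqP => //= [pq|]; last by rewrite subr0.
have -> : q = - p by lia.
rewrite oppr_gt0; case: ltgtP => [p0|p0|<-]; rewrite ?subr0 ?sub0r ?mul0r //.
by rewrite -mulNr mulrNz opprK.
Qed.

(** * The energy of a singular vector *)

(** Here n is the largest index with a_n v <> 0. Expand each L_(n-r) v in the sum
    of (3 r - n) a_r L_(n-r) v over r: only r = n contributes, with 2 n h a_n v.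
    On the other hand it is a cubic sum over r + p + q = n. If the three factors
    are fully normal ordered, it is symmetric, and 3 r - n averages to zero over
    the permutations of (r, p, q), so it vanishes. What remains is the reordering
    of a_r past a_p and a_q, which is a multiple of a_n v because the third index
    is then n. *)
Section Top.
Variables (n : nat) (v : V) (h : K).
Hypothesis n_gt0 : (0 < n)%N.
Hypothesis v_top : forall k : int, n%:Z < k -> a k v = 0.
Hypothesis v_sing : singular v.
Hypothesis v_L0 : L 0 v = h *: v.

(* All modes that occur have index at most n, hence at least - n as well,
   because the three indices add up to n. *)
Let I := zseq n.
Let tri (w : int -> int -> int -> V) :=
  \sum_(r <- I) \sum_(p <- I) \sum_(q <- I | r + p + q == n%:Z) w r p q.

Let eq_tri w w' : (forall r p q, r + p + q = n%:Z -> w r p q = w' r p q) ->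
  tri w = tri w'.
Proof.
move=> ww; apply: eq_bigr => r _; apply: eq_bigr => p _.
by apply: eq_bigr => q /eqP; exact: ww.
Qed.

Let tri12 w : tri w = tri (fun r p q => w p r q).
Proof.
rewrite /tri exchange_big; apply: eq_bigr => r _; apply: eq_bigr => p _.
by apply: eq_bigl => q; rewrite (addrC p r).
Qed.

Let tri23 w : tri w = tri (fun r p q => w r q p).
Proof.
apply: eq_bigr => r _; under eq_bigr do rewrite big_mkcond.
rewrite exchange_big; apply: eq_bigr => p _; rewrite -big_mkcond /=.
by apply: eq_bigl => q; rewrite addrAC.
Qed.

Let triD w w' : tri (fun r p q => w r p q + w' r p q) = tri w + tri w'.
Proof.
rewrite /tri -big_split; apply: eq_bigr => r _; rewrite -big_split.
by apply: eq_bigr => p _; rewrite -big_split.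
Qed.

Let triZ c w : tri (fun r p q => c *: w r p q) = c *: tri w.
Proof.
rewrite /tri scaler_sumr; apply: eq_bigr => r _; rewrite scaler_sumr.
by apply: eq_bigr => p _; rewrite scaler_sumr.
Qed.

Let vir_box k : 0 <= k -> L k v = \sum_(p <- I) \sum_(q <- I | p + q == k) nprod H p q v.
Proof.
move=> k0; have zero p : (n < `|p|)%N -> nprod H p (k - p) v = 0.
  move=> np; have [k_eq0|k_neq0] := eqVneq k 0.
    by rewrite k_eq0 sub0r nprod_opp v_top ?linear0 //; lia.
  rewrite nprod_neq ?subrKC //; have [p0|p0] := ltP 0 p.
    by rewrite op_sl2H_comm ?subrKC // v_top ?linear0 //; lia.
  by rewrite v_top ?linear0 //; lia.
rewrite vir_zsum (zsumE zero); apply: eq_big_seq => p; rewrite mem_zseq => pn.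
have [qI|qI] := boolP (k - p \in I).
  rewrite big_mkcond (bigD1_seq (k - p)) ?zseq_uniq //= subrKC eqxx.
  rewrite big1 ?addr0 // => q qk; case: eqP => // E; case/eqP: qk; lia.
rewrite big_seq_cond big1 => [|q /andP[qn /eqP kq]]; last first.
  by rewrite -kq addrC addKr qn in qI.
rewrite mem_zseq -ltnNge in qI.
have [p0|p0] := ltP n%:Z (k - p).
  rewrite /nprod v_top // linear0 sub0r /nconst subrKC.
  by case: eqP => [k_eq0|]; [case: ltP => //; lia|rewrite scale0r oppr0].
by lia.
Qed.

(* The fully normal ordered product of a_r, a_p and a_q applied to v, when
   r + p + q = n. *)
Let sym r p q := a r (a p (a q v)) - (nconst R r p + nconst R r q + nconst R p q) *: a n v.

Let sym23 r p q : r + p + q = n%:Z -> sym r p q = sym r q p.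
Proof.
move=> rpq; rewrite /sym (comm_aa H p q) linearD linearZ /= -nconst_diff.
rewrite addrAC.
have -> : (nconst R p q - nconst R q p) *: a r v = (nconst R p q - nconst R q p) *: a n v.
  rewrite nconst_diff; case: eqP => [pq|]; last by rewrite !scale0r.
  by have -> : r = n%:Z by lia.
rewrite -addrA; congr (_ + _); rewrite -!scaleNr -scalerDl; congr (_ *: _).
by ring.
Qed.

Let sym12 r p q : r + p + q = n%:Z -> sym r p q = sym p r q.
Proof.
move=> rpq; rewrite /sym (comm_aa H r p) -nconst_diff.
have -> : (nconst R r p - nconst R p r) *: a q v = (nconst R r p - nconst R p r) *: a n v.
  rewrite nconst_diff; case: eqP => [pq|]; last by rewrite !scale0r.
  by have -> : q = n%:Z by lia.
rewrite -addrA; congr (_ + _); rewrite -!scaleNr -scalerDl; congr (_ *: _).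
by ring.
Qed.

Let tri_sym : tri (fun r p q => (3%:R * r%:~R - n%:R : K) *: sym r p q) = 0.
Proof.
set A := tri (fun r p q => (r%:~R : K) *: sym r p q).
have A2 : A = tri (fun r p q => (p%:~R : K) *: sym r p q).
  by rewrite /A tri12; apply: eq_tri => r p q rpq; rewrite sym12 // -rpq; lia.
have A3 : A = tri (fun r p q => (q%:~R : K) *: sym r p q).
  by rewrite A2 tri23; apply: eq_tri => r p q rpq; rewrite sym23 // -rpq; lia.
have E : A + A + A = tri (fun r p q => (n%:R : K) *: sym r p q).
  rewrite {2}A2 {2}A3 /A -!triD; apply: eq_tri => r p q rpq.
  by rewrite -!scalerDl -!intrD rpq.
have -> : tri (fun r p q => (3%:R * r%:~R - n%:R : K) *: sym r p q)
   = 3%:R *: A + (-1) *: tri (fun r p q => (n%:R : K) *: sym r p q).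
  rewrite /A -!triZ -triD; apply: eq_tri => r p q rpq.
  by rewrite !scalerA -scalerDl mulN1r.
by rewrite -E scaleN1r scaler_nat !mulrS mulr0n addr0 addrA subrr.
Qed.

Let sum_pos (F : int -> K) :
  \sum_(r <- I) (if 0 < r then F r else 0) = \sum_(k < n) F k.+1%:Z.
Proof.
rewrite /I /zseq big_map (_ : (2 * n).+1 = (n.+1 + n)%N); last lia.
rewrite iotaD big_cat -[LHS]/(_ + _) [X in X + _]big1_seq ?add0r => [|k]; last first.
  by rewrite mem_iota => /andP[_ kn]; rewrite ifF //; lia.
rewrite add0n -{1}[n.+1]addn0 iotaDl big_map.
have -> : iota 0 n = index_iota 0 n by rewrite /index_iota subn0.
rewrite big_mkord.
by apply: eq_bigr => k _; rewrite ifT; [congr F; lia|lia].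
Qed.

Let sum_reorder (c : int -> K) :
  tri (fun r p q => (c r * nconst R r p) *: a n v) =
  (\sum_(r <- I) (if 0 < r then c r * (r%:~R / 2%:R) else 0)) *: a n v.
Proof.
rewrite scaler_suml; apply: eq_big_seq => r; rewrite mem_zseq => rn.
rewrite (bigD1_seq (- r)) ?zseq_uniq ?mem_zseq //=; last by lia.
rewrite [X in _ + X]big1 ?addr0 => [|p pr]; last first.
  by apply: big1 => q _; rewrite /nconst ifF ?mulr0 ?scale0r //; lia.
rewrite big_mkcond (bigD1_seq n%:Z) ?zseq_uniq ?mem_zseq //=.
rewrite [X in _ + X]big1 ?addr0 => [|q qn]; last by rewrite ifF //; lia.
rewrite subrr add0r eqxx /nconst subrr eqxx /=.
by case: ifP; rewrite ?mulr0.
Qed.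

Let closed_form (m : nat) :
  \sum_(k < m) (3%:R * k.+1%:Z%:~R - n%:R) * (k.+1%:Z%:~R / 2%:R) * 2%:R =
  (m%:R * (m%:R + 1) * (2%:R * m%:R + 1 - n%:R) / 2%:R : K).
Proof.
elim: m => [|m IHm]; first by rewrite big_ord0 !mul0r.
by rewrite big_ord_recr /= IHm -!pmulrn -[m.+1]addn1 natrD; field.
Qed.

Lemma top_mode_energy : a n v != 0 -> h *+ 4 = n.+1%:R ^+ 2.
Proof.
move=> anv.
have E1 : tri (fun r p q => (3%:R * r%:~R - n%:R : K) *: a r (nprod H p q v)) =
    (n%:R * 2%:R * h) *: a n v.
  rewrite /tri (eq_big_seq (fun r : int => (3%:R * r%:~R - n%:R : K) *: a r (L (n%:Z - r) v))).
    rewrite (bigD1_seq n%:Z) ?zseq_uniq ?mem_zseq //= subrr v_L0 linearZ /= scalerA.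
    rewrite big_seq_cond big1 => [|r /andP[rn rn']].
      by rewrite addr0; congr (_ *: _); rewrite -pmulrn; ring.
    by rewrite mem_zseq in rn; rewrite v_sing ?linear0 ?scaler0 //; lia.
  move=> r; rewrite mem_zseq => rn; rewrite vir_box; last lia.
  rewrite linear_sum scaler_sumr; apply: eq_bigr => p _.
  rewrite linear_sum scaler_sumr; apply: eq_bigl => q.
  by apply/eqP/eqP; lia.
have E2 : tri (fun r p q => (3%:R * r%:~R - n%:R : K) *: a r (nprod H p q v)) =
    (n%:R * (n%:R + 1) * (2%:R * n%:R + 1 - n%:R) / 2%:R : K) *: a n v.
  (* nprod p q has p and q ordered already; a_r has to be moved past both *)
  pose c (r : int) : K := 3%:R * r%:~R - n%:R.
  rewrite -[RHS]add0r -tri_sym -closed_form.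
  have -> : \sum_(k < n) (3%:R * k.+1%:Z%:~R - n%:R) * (k.+1%:Z%:~R / 2%:R) * 2%:R =
     2%:R * \sum_(r <- I) (if 0 < r then c r * (r%:~R / 2%:R) else 0) :> K.
    by rewrite sum_pos mulr_sumr; apply: eq_bigr => k _; rewrite mulrC.
  rewrite -scalerA scaler_nat mulr2n -sum_reorder [X in _ + (_ + X)]tri23 -!triD.
  apply: eq_tri => r p q rpq; rewrite -scalerDl -mulrDr -scalerA -scalerDr.
  congr (_ *: _); rewrite /sym /nprod linearB linearZ /=.
  have -> : nconst R p q *: a r v = nconst R p q *: a n v.
    rewrite /nconst; case: eqP => [pq|]; last by rewrite !scale0r.
    by have -> : r = n%:Z by lia.
  by rewrite -addrA -!scaleNr -scalerDl; congr (_ + _ *: _); ring.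
have /eqP : (n%:R * 2%:R * h) *: a n v =
    (n%:R * (n%:R + 1) * (2%:R * n%:R + 1 - n%:R) / 2%:R : K) *: a n v by rewrite -E1 E2.
rewrite -subr_eq0 -scalerBl scaler_eq0 (negPf anv) orbF subr_eq0 => /eqP E.
have n0 : (n%:R : K) != 0 by rewrite pnatr_eq0 -lt0n.
have n2 : (n%:R * 2%:R^-1 : K) != 0 by rewrite mulf_neq0 // invr_eq0 pnatr_eq0.
apply: (mulfI n2); rewrite -mulr_natr -[n.+1]addn1 natrD.
transitivity (n%:R * 2%:R * h); first by field.
by rewrite E; field.
Qed.

End Top.

(** Any vector is killed by all a_k with k large, so unless v is extremal there
    is a last mode a_n that does not kill it. *)
Lemma singular_energy q h v : v != 0 -> state q h v -> singular v ->
  h = q ^+ 2 \/ exists n : nat, h *+ 4 = n.+1%:R ^+ 2.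
Proof.
move=> v0 sv singv.
have [N hN] := op_bound H v.
have [vac|] := pselect (forall k : int, 0 < k -> a k v = 0).
  by left; exact: (vacuum_energy sv).
move=> /existsNP[k0 /not_implyP[k0_gt0 /eqP k0v]].
right; pose P := fun k : nat => (0 < k)%N && (a k v != 0).
have exP : exists k, P k.
  exists `|k0|%N; rewrite /P absz_gt0 gt_eqF //=.
  by rewrite (_ : `|k0|%N%:Z = k0) //; lia.
have ubP k : P k -> (k <= N)%N.
  move=> /andP[_]; apply: contraNT; rewrite -ltnNge => Nk.
  by have [|-> _ _] := hN k.
have [n /andP[n0 nv] nmax] := ex_maxnP exP ubP; exists n.
apply: (top_mode_energy n0 _ singv sv.2 nv) => k nk; apply/eqP/negPn/negP => kv.
have : P `|k|%N.
  rewrite /P absz_gt0 gt_eqF /=; last by lia.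
  by rewrite (_ : `|k|%N%:Z = k) //; lia.
by move/nmax; lia.
Qed.
End States.

(** * Uniqueness of singular vectors *)

Section Unique.
Variables (R : realType) (V : lmodType R[i]) (H : level1_rep V).
Local Notation K := R[i].
Local Notation a := (op H sl2H).
Local Notation e := (op H sl2E).
Local Notation f := (op H sl2F).
Local Notation L := (vir H).

Definition modes (s : seq nat) (v : V) : V := foldr (fun k : nat => a k) v s.

Lemma modes_cat s t v : modes (s ++ t) v = modes s (modes t v).
Proof. exact: foldr_cat. Qed.

Lemma modes_lin s c u v : modes s (c *: u + v) = c *: modes s u + modes s v.
Proof. by elim: s => //= k s ->; rewrite linearP. Qed.

Lemma modes0 s : modes s 0 = 0.
Proof. by elim: s => //= k s ->; rewrite linear0. Qed.

Lemma modesB s c u v : modes s (u - c *: v) = modes s u - c *: modes s v.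
Proof. by have := modes_lin s (- c) v u; rewrite !scaleNr addrC => ->; rewrite addrC. Qed.

Local Notation pos := (all (leq 1)).

Lemma modes_comm (k : nat) s v : (0 < k)%N -> modes s (a k v) = a k (modes s v).
Proof. by move=> k0; elim: s => //= l s ->; rewrite op_sl2H_comm //; lia. Qed.

Lemma state_modes q h s v : state H q h v -> state H q (h - (sumn s)%:R) (modes s v).
Proof.
move=> sv; elim: s => [|k s IHs] /=; first by rewrite subr0.
by have := state_a k IHs; rewrite -pmulrn -addrA -opprD -natrD addnC.
Qed.

(** A vector that is not extremal is not killed by some a_k with k > 0, and a_k
    lowers its excess of energy over q^2 by k; after finitely many steps an
    extremal vector is reached. This is the dual form of the fact that the a_(-k)
    generate the Fock space. *)
Lemma modes_eq0 N q v : state H q (q ^+ 2 + N%:R) v ->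
  (forall s, pos s -> sumn s = N -> modes s v = 0) -> v = 0.
Proof.
elim/ltn_ind: N v => N IHN v sv vs0; apply/eqP/negPn/negP => v0.
case: N IHN sv vs0 => [|N] IHN sv vs0.
  by have := vs0 [::] isT erefl; move/eqP: v0.
have [vac|] := pselect (forall k : int, 0 < k -> a k v = 0).
  have /eqP := vacuum_energy sv vac v0.
  by rewrite addrC -subr_eq0 addrK pnatr_eq0.
move=> /existsNP[k /not_implyP[k_gt0 kv]].
have [kE|] := leP k N.+1%:Z; last first.
  move=> kN; apply: kv; apply: (state_eq0 (state_a k sv)).
  have -> : q ^+ 2 + N.+1%:R - k%:~R - q ^+ 2 = N.+1%:R - k%:~R by ring.
  rewrite subr_lt0.
  by rewrite pmulrn ltr_int.
have {}kE : k = `|k|%N%:Z /\ (`|k| <= N.+1)%N by lia.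
move: kE kv k_gt0; move: `|k|%N => l [-> lN] lv l0.
apply: lv; apply: (IHN (N.+1 - l)%N); first by lia.
  by have := state_a l sv; rewrite -pmulrn -addrA -natrB.
move=> s ps ss; rewrite modes_comm; last by lia.
apply: (vs0 (l :: s)); rewrite /= ?ps ?andbT; lia.
Qed.

Lemma vir_a1 (j n : nat) y : (0 < n)%N -> L n (modes (nseq j 1) y) =
  modes (nseq j 1) (L n y) - j%:R *: modes (nseq j.-1 1) (a n.+1 y).
Proof.
move=> n0; elim: j => [|j IHj]; first by rewrite scale0r subr0.
have /eqP := comm_aL H 1 n (modes (nseq j 1) y).
rewrite scale1r -subr_eq => /eqP /= <-.
rewrite IHj linearB linearZ /= -addrA; congr (_ + _).
rewrite (_ : n%:Z + 1 = n.+1); last lia.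
rewrite -(modes_comm _ _ (ltn0Sn n)).
have -> : j%:R *: a 1 (modes (nseq j.-1 1) (a n.+1 y)) =
          j%:R *: modes (nseq j 1) (a n.+1 y).
  by case: j {IHj} => [|j] //=; rewrite !scale0r.
by rewrite -opprD -[in RHS]natr1 scalerDl scale1r.
Qed.

(** Pairing v with the monomials in the a_(-k) turns its coefficients into the
    values [modes s v]. Downward induction on the number j of indices equal to 1
    shows that they all vanish as soon as a_1^N v does: if a_1^(j+1) a_s v has
    energy q^2 + n then L_n maps it to a combination of products with at least
    j + 1 factors a_1, hence to zero by induction, while commuting L_n to the
    right, where it kills v, gives - (j + 1) a_1^j a_(n+1) a_s v up to products
    of the same kind. *)
Section Key.
Variables (q : K) (N : nat) (v : V).
Hypothesis sv : state H q (q ^+ 2 + N%:R) v.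
Hypothesis v_sing : singular H v.

Let killed j := forall s, pos s -> (j + sumn s = N)%N -> modes (nseq j 1 ++ s) v = 0.

Let modes_insert (k : nat) s t w : (0 < k)%N -> modes (s ++ k :: t) w = a k (modes (s ++ t) w).
Proof. by move=> k0; rewrite !modes_cat /= modes_comm. Qed.

Section Step.
Variable j : nat.
Hypothesis killed_j : killed j.+1.

(* t collects the modes that L_n has already passed. *)
Let vir_inside n s t : (0 < n)%N -> pos s -> pos t ->
  (j.+1 + sumn t + sumn s + n = N)%N ->
  modes (nseq j.+1 1) (modes t (L n (modes s v))) = 0.
Proof.
move=> n0; elim: s t => [|k s IHs] t.
  by rewrite [L n _]v_sing ?modes0.
move=> /andP[k0 ps']; have {ps'}ps : pos s := ps'; move=> pt.
rewrite [sumn (k :: s)]/= [modes (k :: s) v]/= => sN.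
have /eqP := comm_aL H k n (modes s v); rewrite -subr_eq => /eqP <-.
rewrite !modesB.
have -> : modes t (a k (L n (modes s v))) = modes (t ++ [:: k]) (L n (modes s v)).
  by rewrite modes_cat.
have ptk : pos (t ++ [:: k]) by rewrite all_cat pt /= k0.
rewrite IHs //; last by rewrite sumn_cat /=; lia.
have -> : modes t (a (n%:Z + k%:Z) (modes s v)) = modes (t ++ (n + k)%N :: s) v.
  by rewrite modes_cat.
rewrite -modes_cat killed_j ?scaler0 ?subr0 //.
  by rewrite all_cat pt /= ps andbT; lia.
by rewrite sumn_cat /=; lia.
Qed.

Let vir_outside n s : (0 < n)%N -> pos s -> (j.+1 + sumn s + n = N)%N ->
  L n (modes (nseq j.+1 1 ++ s) v) = 0.
Proof.
move=> n0 ps sN; set w := modes _ v.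
have sw : state H q (q ^+ 2 + n%:R) w.
  have := state_modes (nseq j.+1 1 ++ s) sv; congr (state H _ _ _).
  by rewrite sumn_cat sumn_nseq mul1n -sN natrD; ring.
have aw0 (k : int) : n%:Z < k -> a k w = 0.
  move=> nk; apply: (state_eq0 (state_a k sw)).
  have -> : q ^+ 2 + n%:R - k%:~R - q ^+ 2 = n%:R - k%:~R by ring.
  by rewrite subr_lt0 pmulrn ltr_int.
have anw : a n w = 0.
  rewrite -modes_insert // killed_j //= ?ps ?andbT //; lia.
rewrite vir_zsum; apply: fsbig1 => p _.
have np0 : p + (n%:Z - p) != 0 by rewrite subrKC; lia.
(* A mode beyond n would take w below the energy bound, and the terms with both
   indices in [0, n] are products to which the hypothesis on j + 1 applies. *)
rewrite nprod_neq //; have [p0|p0] := ltP p 0; first by rewrite aw0 ?linear0 //; lia.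
have [np|pn] := ltP n%:Z p; first by rewrite op_sl2H_comm // aw0 ?linear0 //; lia.
have [->|pn0] := eqVneq p 0.
  by rewrite subr0 anw linear0.
have [->|pnn] := eqVneq p n%:Z.
  by rewrite subrr sw.1 linearZ /= anw scaler0.
have -> : p = `|p|%N%:Z by lia.
have -> : n%:Z - `|p|%N%:Z = `|n%:Z - p|%N%:Z by lia.
rewrite -!modes_insert ?absz_gt0 //; last by rewrite subr_eq0 eq_sym.
rewrite killed_j //= ?ps ?absz_gt0 ?andbT //; last by lia.
by rewrite pn0 subr_eq0 eq_sym.
Qed.

Lemma killed_step : (j < N)%N -> killed j.
Proof.
move=> jN [|[|[|k]] s] //= ps sN; first by lia.
- by rewrite modes_insert //; apply: (killed_j ps); lia.
have E : L k.+1 (modes (nseq j.+1 1) (modes s v)) = 0.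
  by rewrite -modes_cat vir_outside //; lia.
have E' : modes (nseq j.+1 1) (L k.+1 (modes s v)) = 0.
  by apply: (@vir_inside k.+1 s [::]) => //; rewrite /=; lia.
move: E; rewrite (vir_a1 j.+1) // E' sub0r => /eqP.
by rewrite oppr_eq0 scaler_eq0 pnatr_eq0 /= => /eqP <-; rewrite modes_cat.
Qed.
End Step.

Lemma singular_eq0 : modes (nseq N 1) v = 0 -> v = 0.
Proof.
move=> vN; apply: (modes_eq0 sv) => s ps ss.
have killed_N : killed N.
  move=> t pt tN; have : t = [::] by case: t pt tN => //= x t /andP[]; lia.
  by move=> ->; rewrite cats0.
suff Q0 : killed 0 by apply: (Q0 s).
have : forall i, (i <= N)%N -> killed (N - i)%N.
  elim=> [|i IHi] iN; first by rewrite subn0.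
  by apply: killed_step; [rewrite subnSK //; apply: IHi; exact: ltnW|lia].
by move=> /(_ N (leqnn N)); rewrite subnn.
Qed.
End Key.

(** Both a_1^N u and a_1^N v are extremal, hence proportional; the matching
    combination of u and v is singular and killed by a_1^N. *)
Lemma singular_line z N u v : extremal_line H z ->
  state H (charge R z) (charge R z ^+ 2 + N%:R) u ->
  state H (charge R z) (charge R z ^+ 2 + N%:R) v ->
  singular H u -> singular H v -> u != 0 -> exists c : K, v = c *: u.
Proof.
move=> [w w0 [_ wu]] su sv uS vS u0.
have ext x : state H (charge R z) (charge R z ^+ 2 + N%:R) x -> extremal H z (modes (nseq N 1) x).
  by move=> /(state_modes (nseq N 1)); rewrite sumn_nseq mul1n addrK.
have [c uE] := wu _ (ext _ su); have [d vE] := wu _ (ext _ sv).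
have c0 : c != 0.
  apply: contraNneq u0 => c0; apply/eqP/(singular_eq0 su uS).
  by rewrite uE c0 scale0r.
exists (d / c); apply/eqP; rewrite -subr_eq0; apply/eqP.
have BE : v - (d / c) *: u = (- (d / c)) *: u + v by rewrite scaleNr addrC.
have sB : state H (charge R z) (charge R z ^+ 2 + N%:R) (v - (d / c) *: u).
  by rewrite BE; exact: state_lin.
apply: (singular_eq0 sB) => [n n0|].
  by rewrite BE vir_lin uS // vS // scaler0 addr0.
by rewrite modesB uE vE scalerA divfK // subrr.
Qed.

Hypothesis Hirr : irreducible_rep H.
Hypothesis g_neq0 : exists2 g, g != 0 & grade H 0 g.
Hypothesis e0sq : forall g, grade H 0 g -> e 0 (e 0 g) = 0.

Lemma extremal_e0 z v : extremal H z v -> e 0 v = 0.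
Proof.
move=> ev; apply: (state_eq0 (state_e Hirr g_neq0 e0sq 0 ev)).
have -> : charge R z ^+ 2 - 0%:~R - (charge R z + 1) ^+ 2 = - (z.+1)%:R.
  by rewrite /charge -natr1; field.
by rewrite oppr_lt0 ltr0n.
Qed.

Lemma comm_e0f0 v : e 0 (f 0 v) = f 0 (e 0 v) + 2%:R *: a 0 v.
Proof. by rewrite comm_ef addr0 eqxx mulr0z scale0r addr0. Qed.

(** The vectors f_0^i w form a string of the spin z / 2 representation of sl2;
    they are all singular, because L_n commutes with e_0 and f_0. *)
Section Descent.
Variables (z : nat) (w : V).
Hypothesis ew : extremal H z w.
Hypothesis w0 : w != 0.
Let u i := iter i (f 0) w.

Lemma descent_state i : state H (charge R z - i%:R) (charge R z ^+ 2) (u i).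
Proof.
elim: i => [|i IHi]; first by rewrite subr0.
have := state_f Hirr g_neq0 e0sq 0 IHi; rewrite subr0 -[i.+1]addn1 natrD opprD addrA.
by rewrite /u addn1.
Qed.

Lemma descent_e0 i : e 0 (u i.+1) = (i.+1%:R * (z%:R - i%:R)) *: u i.
Proof.
elim: i => [|i IHi].
  rewrite /u /= comm_e0f0 (extremal_e0 ew) linear0 add0r ew.1 scalerA.
  by congr (_ *: _); rewrite /charge; field.
rewrite [u i.+2]/= comm_e0f0 IHi linearZ /= (descent_state i.+1).1.
rewrite scalerA -scalerDl; congr (_ *: _).
by rewrite /charge -[i.+2]addn2 -[i.+1]addn1 !natrD; field.
Qed.

Lemma descent_neq0 i : (i <= z)%N -> u i != 0.
Proof.
elim: i => // i IHi iz; apply: contraTneq (IHi (ltnW iz)) => ui; rewrite negbK.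
have /esym/eqP := descent_e0 i; rewrite ui linear0 scaler_eq0 mulf_eq0 pnatr_eq0 /=.
by rewrite subr_eq0 eqr_nat gtn_eqF.
Qed.

Lemma descent_singular i : singular H (u i).
Proof. by elim: i => [|i IHi]; [exact: extremal_singular ew|exact: singular_f0]. Qed.
End Descent.

(** The difference m^2 - z^2 is divisible by 4, so m and z have the same
    parity. *)
Lemma square_shift (z m N : nat) : (z ^ 2 + 4 * N = m ^ 2)%N ->
  exists d : nat, m = (z + d.*2)%N /\ N = (d * (z + d))%N.
Proof.
move=> E; have zm : (z <= m)%N by rewrite -(@leq_exp2r z m 2) // -E leq_addr.
move: E; rewrite -(subnKC zm); move: (m - z)%N => t E.
have E' : (t * (t + z.*2) = 4 * N)%N by lia.
have t_even : ~~ odd t.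
  by move: (congr1 odd E'); rewrite !oddM oddD odd_double addbF andbb /= => ->.
exists t./2; rewrite even_halfK //; split=> //.
move: E'; rewrite -{1 2}[t]even_halfK //; lia.
Qed.

(** Let q be the charge of v. Its energy is k^2 with k in q + N by
    [singular_energy] and [square_shift]. If k = q + d with d > 0, then v is a
    multiple of f_0^d w, with w extremal of charge k, and e_0 does not kill
    this vector. *)
Lemma singular_highest J r N v : extremal_line H J ->
  state H (charge R (J + r.*2)) (charge R (J + r.*2) ^+ 2 + N%:R) v ->
  singular H v -> e 0 v = 0 -> v != 0 -> N = 0%N.
Proof.
move=> lJ; set z := (J + r.*2)%N => sv vS ev v0.
case: (singular_energy v0 sv vS) => [/eqP|[n nE]].
  by rewrite addrC -subr_eq0 addrK pnatr_eq0 => /eqP.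
have /square_shift[d [zd Nd]] : (z ^ 2 + 4 * N = n.+1 ^ 2)%N.
  apply/eqP; rewrite -(eqr_nat K) natrX -nE natrD natrM natrX; apply/eqP.
  by rewrite /charge; field.
case: d zd Nd => [|d] zd Nd; first by rewrite Nd.
have [w w0 [ew _]] := extremal_line_add Hirr g_neq0 e0sq (r + d.+1) lJ.
have {ew} ew : extremal H (z + d.+1.*2) w by rewrite /z -addnA -doubleD.
have hE : charge R (z + d.+1.*2) ^+ 2 = charge R z ^+ 2 + N%:R.
  by rewrite /charge Nd -muln2 !natrD !natrM !natrD; field.
have su : state H (charge R z) (charge R z ^+ 2 + N%:R) (iter d.+1 (f 0) w).
  have := descent_state ew d.+1; rewrite hE; congr (state H _ _ _).
  by rewrite /charge -muln2 !natrD !natrM; field.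
have lz : extremal_line H z by exact: extremal_line_add.
have u0 := descent_neq0 ew w0.
have ud : iter d.+1 (f 0) w != 0 by apply: u0; lia.
have [c vE] := singular_line lz su sv (descent_singular ew d.+1) vS ud.
move: ev; rewrite vE linearZ /= -[f 0 _]/(iter d.+1 (f 0) w) (descent_e0 ew) => /eqP.
rewrite !scaler_eq0 (negPf (u0 d _)); last by lia.
rewrite pnatr_eq0 subr_eq0 eqr_nat /= orbF.
have -> : (z + d.+1.*2 == d)%N = false by lia.
rewrite orbF.
by move=> /eqP c0; move: v0; rewrite vE c0 scale0r eqxx.
Qed.

End Unique.

(** * Orthogonal projection *)

Section Projection.
Variables (R : realType) (V : lmodType R[i]) (H : level1_rep V).
Local Notation K := R[i].
Local Notation "''[' u , v ]" := (inner H u v).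

Lemma ip_neq0 v : v != 0 -> '[v, v] != 0.
Proof. by move=> v0; rewrite gt_eqF //; exact: neq0_dnorm_gt0. Qed.

(** By induction on the number of vectors whose span contains W: splitting off a
    nonzero t in W, the subspace of W orthogonal to t lies in the span of the
    projections of these vectors along t, and the relation that expresses t
    makes one of them redundant. *)
Lemma ortho_proj (W : set V) : subspace W -> fin_dim W ->
  forall u, exists x, W x /\ forall w, W w -> '[u - x, w] = 0.
Proof.
move=> sW [d [s Ws]]; elim: d W sW s Ws => [|d IHd] W sW s Ws u.
  exists 0; split=> [|w /Ws[c ->]]; first exact: subspace_0.
  by rewrite big_ord0 ip0r.
have [W0|] := pselect (forall w, W w -> w = 0).
  by exists 0; split=> [|w /W0 ->]; [exact: subspace_0|exact: ip0r].
move=> /existsNP[t /not_implyP[Wt /eqP t0]].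
have tt := ip_neq0 t0.
pose W' := [set w | W w /\ '[w, t] = 0].
have sW' : subspace W'.
  split=> [|c x y [Wx xt] [Wy yt]]; first by split; [exact: subspace_0|exact: ip0l].
  by split; [exact: sW.2|rewrite ipDl ipZl xt yt mulr0 addr0].
pose pr x := x - ('[x, t] / '[t, t]) *: t.
have prt x : '[pr x, t] = 0.
  by rewrite /pr -scaleNr ipDl ipZl mulNr divfK // subrr.
have prW x : W x -> W' (pr x).
  by move=> Wx; split; [apply: (subspaceB sW) => //; exact: subspaceZ|exact: prt].
have pr_lin c x y : pr (c *: x + y) = c *: pr x + pr y.
  rewrite /pr ipDl ipZl mulrDl scalerDl scalerBr !scalerA -mulrA opprD.
  by rewrite [LHS]addrACA.
have pr_sum n (c : 'I_n -> K) (x : 'I_n -> V) :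
    pr (\sum_(k < n) c k *: x k) = \sum_(k < n) c k *: pr (x k).
  elim: n c x => [|n IHn] c x.
    by rewrite !big_ord0 /pr ip0l mul0r scale0r subrr.
  by rewrite !big_ord_recl pr_lin IHn.
have [c tE] := Ws _ Wt.
have [k ck] : exists k, c k != 0.
  apply: contrapT => /forallNP ck; case/eqP: t0; rewrite tE big1 // => k _.
  by move: (ck k) => /negP; rewrite negbK => /eqP ->; rewrite scale0r.
have prs_k : c k *: pr (s k) = - \sum_(l < d) c (lift k l) *: pr (s (lift k l)).
  have : \sum_(l < d.+1) c l *: pr (s l) = 0.
    by rewrite -pr_sum -tE /pr divff // scale1r subrr.
  by rewrite (bigD1_ord k) //= => /eqP; rewrite addr_eq0 => /eqP.
have W's w : W' w -> exists b : 'I_d -> K, w = \sum_(l < d) b l *: pr (s (lift k l)).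
  move=> [/Ws[b wE] wt].
  have -> : w = pr w by rewrite /pr wt mul0r scale0r subr0.
  rewrite wE pr_sum (bigD1_ord k) //=.
  exists (fun l => b (lift k l) - b k / c k * c (lift k l)).
  have -> : b k *: pr (s k) = (b k / c k) *: (c k *: pr (s k)).
    by rewrite scalerA divfK.
  rewrite prs_k scalerN scaler_sumr addrC -sumrB; apply: eq_bigr => l _.
  by rewrite scalerA -scalerBl.
have [x [[Wx xt] xo]] := IHd W' sW' _ W's (pr u).
exists (x + ('[u, t] / '[t, t]) *: t); split.
  by apply: (subspaceD sW) => //; exact: subspaceZ.
move=> w Ww; rewrite opprD addrA addrAC -/(pr u).
have E : '[pr u - x, t] = 0 by rewrite ipDl prt -scaleN1r ipZl xt mulr0 addr0.
have -> : w = pr w + ('[w, t] / '[t, t]) *: t by rewrite subrK.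
by rewrite ipDr ipZr E mulr0 addr0; exact: xo (prW _ Ww).
Qed.
End Projection.

(** * The lowest energy space *)

Section TwoByTwo.
Variable K : numFieldType.
Implicit Types A B X : 'M[K]_2.

Lemma cayley_hamilton2 A :
  A *m A = \tr A *: A - (A 0 0 * A 1 1 - A 0 1 * A 1 0) *: 1%:M.
Proof.
by apply: mx2P; rewrite mulmx2E tr2E !mxE /=; ring.
Qed.

Variables Hm E F : 'M[K]_2.
Hypothesis HE : Hm *m E - E *m Hm = E.
Hypothesis EF : E *m F - F *m E = 2%:R *: Hm.
Hypothesis E0 : E != 0.

(** E is a commutator and so is E^2, so both have trace zero. *)
Lemma nilp_sq : E *m E = 0.
Proof.
have trE : \tr E = 0 by rewrite -HE; exact: sl2_lie.
have := cayley_hamilton2 E; rewrite trE scale0r sub0r; set dt := _ - _ => EE.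
have : \tr (E *m E) = 0.
  by rewrite -{2}HE mulmxBr linearB /= !mulmxA mxtrace_mulC mulmxA subrr.
rewrite EE linearN linearZ /= mxtrace1 => /eqP.
by rewrite oppr_eq0 mulf_eq0 pnatr_eq0 orbF => /eqP ->; rewrite scale0r oppr0.
Qed.

(** Since H^2 is a scalar, HE = - EH; with HE - EH = E this gives 2 HE = E. *)
Lemma half_HE : Hm *m E = 2%:R^-1 *: E.
Proof.
have trH : \tr Hm = 0.
  have /eqP : \tr (2%:R *: Hm) = 0 by rewrite -EF; exact: sl2_lie.
  by rewrite linearZ /= mulf_eq0 pnatr_eq0 /= => /eqP.
have := cayley_hamilton2 Hm; rewrite trH scale0r sub0r; set dt := _ - _ => HH.
have C : Hm *m Hm *m E = E *m (Hm *m Hm).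
  by rewrite HH mulNmx mulmxN -scalemxAl -scalemxAr mul1mx mulmx1.
have S : Hm *m E = - (E *m Hm).
  have H1 : Hm *m E = Hm *m Hm *m E - Hm *m E *m Hm.
    by rewrite -{1}HE mulmxBr !mulmxA.
  have H2 : E *m Hm = Hm *m E *m Hm - Hm *m Hm *m E.
    by rewrite C -{1}HE mulmxBl !mulmxA.
  by rewrite H1 H2 opprB.
apply: (scalerI (a := 2%:R)); first by rewrite pnatr_eq0.
by rewrite scalerA divff ?pnatr_eq0 // scale1r -[RHS]HE -S scaler_nat mulr2n.
Qed.

Lemma half_exists : exists2 x : 'cV[K]_2, x != 0 & Hm *m x = 2%:R^-1 *: x.
Proof.
have [k Ek] : exists k, col k E != 0.
  apply: contrapT => /forallNP Ek; case/eqP: E0; apply/matrixP => r k.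
  by have /negP := Ek k; rewrite negbK => /eqP /matrixP /(_ r 0); rewrite !mxE.
exists (col k E) => //.
by rewrite !colE mulmxA half_HE scalemxAl.
Qed.

Lemma half_E0 (x : 'cV[K]_2) : Hm *m x = 2%:R^-1 *: x -> E *m x = 0.
Proof.
move=> Hx; have := congr1 (mulmx^~ x) HE.
rewrite mulmxBl -!mulmxA Hx -scalemxAr mulmxA half_HE -scalemxAl => /eqP.
by rewrite subrr eq_sym => /eqP.
Qed.

(** E kills the eigenvectors of H for 1/2, so two independent ones would make
    E zero. *)
Lemma half_unique (x y : 'cV[K]_2) : x != 0 ->
  Hm *m x = 2%:R^-1 *: x -> Hm *m y = 2%:R^-1 *: y -> exists c, y = c *: x.
Proof.
move=> x0 /half_E0 Ex /half_E0 Ey.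
have mulc (A : 'M[K]_2) (z : 'cV[K]_2) i : (A *m z) i 0 = A i 0 * z 0 0 + A i 1 * z 1 0.
  rewrite mxE !big_ord_recl big_ord0 addr0; congr (_ + _ * _); congr (_ _ _); exact/val_inj.
have det0 : x 0 0 * y 1 0 = x 1 0 * y 0 0.
  apply/eqP; rewrite -subr_eq0; apply: contraNT E0 => d0.
  have Ei i : E i 0 = 0 /\ E i 1 = 0.
    have := mulc E x i; have := mulc E y i; rewrite Ex Ey !mxE => /esym hy /esym hx.
    split; apply: (mulIf d0); rewrite mul0r.
      transitivity (y 1 0 * (E i 0 * x 0 0 + E i 1 * x 1 0) -
                    x 1 0 * (E i 0 * y 0 0 + E i 1 * y 1 0)); first by ring.
      by rewrite hx hy !mulr0 subrr.
    transitivity (x 0 0 * (E i 0 * y 0 0 + E i 1 * y 1 0) -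
                  y 0 0 * (E i 0 * x 0 0 + E i 1 * x 1 0)); first by ring.
    by rewrite hx hy !mulr0 subrr.
  by apply/eqP/mx2P; rewrite mxE; have [] := Ei 0; have [] := Ei 1.
have colP (u v : 'cV[K]_2) : u 0 0 = v 0 0 -> u 1 0 = v 1 0 -> u = v.
  by move=> h0 h1; apply/matrixP => i k; rewrite ord1; move: i; exact: ord2P.
have [x00|x00] := eqVneq (x 0 0) 0.
  have x10 : x 1 0 != 0.
    by apply: contraNneq x0 => x10; apply/eqP/colP; rewrite mxE.
  exists (y 1 0 / x 1 0); apply: colP; rewrite mxE ?divfK // x00 mulr0.
  apply: (mulfI x10); rewrite -det0 x00; ring.
exists (y 0 0 / x 0 0); apply: colP; rewrite mxE ?divfK //.
apply: (mulfI x00); rewrite det0; field; exact: x00.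
Qed.
End TwoByTwo.

Section Base.
Variables (R : realType) (V : lmodType R[i]) (H : level1_rep V).
Local Notation K := R[i].
Local Notation a := (op H sl2H).
Local Notation e := (op H sl2E).
Local Notation f := (op H sl2F).
Local Notation D := (energy H).
Local Notation L := (vir H).

(** What the rest of the argument uses of the lowest energy space: E(0)^2 = 0,
    and the vectors of charge j = J / 2 form a line. *)
Definition lowest_line (J : nat) := (forall g, grade H 0 g -> e 0 (e 0 g) = 0) /\
  exists2 g, g != 0 & [/\ grade H 0 g, a 0 g = charge R J *: g &
    forall h, grade H 0 h -> a 0 h = charge R J *: h -> exists c : K, h = c *: g].

Section Rep.
Variables (d : nat) (rho : 'M[K]_2 -> 'M[K]_d).
Hypothesis rho_irr : irr_sl2_rep rho.

Let rho_lin : forall c X Y, sl2 X -> sl2 Y -> rho (c *: X + Y) = c *: rho X + rho Y.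
Proof. by have [] := rho_irr. Qed.

Lemma rho_HE : rho sl2H *m rho sl2E - rho sl2E *m rho sl2H = rho sl2E.
Proof. by have [_ br _] := rho_irr; rewrite -br ?lie_HE //; [exact: sl2_H|exact: sl2_E]. Qed.

Lemma rho_EF : rho sl2E *m rho sl2F - rho sl2F *m rho sl2E = 2%:R *: rho sl2H.
Proof.
have [_ br _] := rho_irr; rewrite -br; [|exact: sl2_E|exact: sl2_F].
by rewrite lie_EF (sl2_linearZ rho_lin) //; exact: sl2_H.
Qed.

Lemma rho_HF : rho sl2H *m rho sl2F - rho sl2F *m rho sl2H = - rho sl2F.
Proof.
have [_ br _] := rho_irr; rewrite -br; [|exact: sl2_H|exact: sl2_F].
by rewrite lie_HF -scaleN1r (sl2_linearZ rho_lin) ?scaleN1r //; exact: sl2_F.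
Qed.

Lemma rho_eq0 : rho sl2E = 0 -> forall X, sl2 X -> rho X = 0.
Proof.
move=> E0; have H0 : rho sl2H = 0.
  apply: (scalerI (a := 2%:R)); first by rewrite pnatr_eq0.
  by rewrite -rho_EF E0 mul0mx mulmx0 subrr scaler0.
have F0 : rho sl2F = 0.
  by apply: oppr_inj; rewrite -rho_HF H0 mul0mx mulmx0 subrr oppr0.
by move=> X sX; rewrite (sl2_linearE rho_lin sX) E0 H0 F0 !scaler0 !addr0.
Qed.
End Rep.

(** On a one-dimensional space the matrices commute, so sl2 acts by zero. *)
Lemma lowest_line0 : lowest_energy_space_is H 0 -> lowest_line 0.
Proof.
move=> [d [rho [phi [dE irr phi_inj phiT phiP]]]].
have d1 : d = 1%N by apply/eqP; rewrite -(eqr_nat rat) dE mulr0 add0r.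
subst d.
have comm1 (A B : 'M[K]_1) : A *m B = B *m A.
  by rewrite [A]mx11_scalar [B]mx11_scalar -!scalar_mxM mulrC.
have E0 : rho sl2E = 0 by rewrite -(rho_HE irr) comm1 subrr.
have act0 X g : sl2 X -> grade H 0 g -> op H X 0 g = 0.
  by rewrite -phiT => sX [x _ <-]; rewrite -phiP // (rho_eq0 irr E0 sX) mul0mx linear0.
split=> [g gg|].
  by rewrite (act0 _ _ (sl2_E K) gg) linear0.
exists (phi 1%:M).
  apply/eqP => p0; have : (1%:M : 'cV[K]_1) = 0 by apply: phi_inj; rewrite p0 linear0.
  by move/matrixP/(_ 0 0); rewrite !mxE => /eqP; rewrite oner_eq0.
have gphi x : grade H 0 (phi x) by rewrite -phiT; exists x.
have hq0 : charge R 0 = 0 by rewrite /charge mul0r.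
split=> [//||h]; first by rewrite hq0 scale0r; apply: act0; [exact: sl2_H|exact: gphi].
rewrite -phiT => -[x _ <-] _; exists (x 0 0).
by rewrite -linearZ /= scalemx1 -mx11_scalar.
Qed.

Lemma lowest_line1 : lowest_energy_space_is H (1 / 2%:R) -> lowest_line 1.
Proof.
move=> [d [rho [phi [dE irr phi_inj phiT phiP]]]].
have d2 : d = 2%N by apply/eqP; rewrite -(eqr_nat rat) dE.
subst d.
have E0 : rho sl2E != 0.
  apply/eqP => E0; have [_ _ [_ _ _ /(_ [set v | v 1 0 = 0])]] := irr.
  case.
  - split=> [|c u v /= u1 v1] /=; first by rewrite mxE.
    by rewrite !mxE u1 v1 mulr0 addr0.
  - by [].
  - move=> _ [X sX ->] v _ /=.
    by rewrite (rho_eq0 irr E0 sX) mul0mx mxE.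
  - move=> S; have : [set v : 'cV[K]_2 | v 1 0 = 0] (delta_mx 0 0) by rewrite /= mxE.
    by rewrite S => /= /matrixP /(_ 0 0); rewrite !mxE /= => /eqP; rewrite oner_eq0.
  - move=> S; have : [set: 'cV[K]_2] (delta_mx 1 0) by [].
    by rewrite -S /= mxE => /eqP; rewrite oner_eq0.
have HE := rho_HE irr; have EF := rho_EF irr.
have hq1 : charge R 1 = 2%:R^-1 by rewrite /charge mul1r.
split=> [g|].
  rewrite -phiT => -[x _ <-]; rewrite -(phiP _ x (sl2_E K)) -(phiP _ _ (sl2_E K)) mulmxA.
  by rewrite (nilp_sq HE) mul0mx linear0.
have [x x0 Hx] := half_exists HE EF E0.
have gphi y : grade H 0 (phi y) by rewrite -phiT; exists y.
exists (phi x).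
  by apply: contraNneq x0 => px; apply/eqP/phi_inj; rewrite px linear0.
split=> [//||h]; first by rewrite -(phiP _ x (sl2_H K)) Hx linearZ hq1.
rewrite -phiT => -[y _ <-]; rewrite -(phiP _ y (sl2_H K)) hq1 -linearZ => /phi_inj Hy.
have [c ->] := half_unique HE EF E0 x0 Hx Hy.
by exists c; rewrite linearZ.
Qed.
End Base.

(** * Irreducibility of the multiplicity spaces *)

Section Main.
Variables (R : realType) (V : lmodType R[i]) (H : level1_rep V).
Local Notation K := R[i].
Local Notation "''[' u , v ]" := (inner H u v).
Local Notation a := (op H sl2H).
Local Notation e := (op H sl2E).
Local Notation f := (op H sl2F).
Local Notation D := (energy H).
Local Notation L := (vir H).

Hypothesis Hirr : irreducible_rep H.
Variables (J r : nat).
Hypothesis base : lowest_line H J.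

Let e0sq : forall g, grade H 0 g -> e 0 (e 0 g) = 0.
Proof. exact: base.1. Qed.
Let g_neq0 : exists2 g, g != 0 & grade H 0 g.
Proof. by have [_ [g g0 [gg _ _]]] := base; exists g. Qed.

Lemma L0_energy v : L 0 v = D v + charge R J ^+ 2 *: v.
Proof.
apply: (vir0_energy Hirr g_neq0 e0sq).
have [_ [g g0 [gg ag _]]] := base; exists g => //; split=> //.
rewrite /vir eqxx ag linearZ /= ag scalerA -expr2 fsbig1 ?scaler0 ?addr0 // => k /= k0.
by rewrite (op_grade_gt (sl2_H _) gg) ?linear0.
Qed.

Lemma extremal_line_J : extremal_line H J.
Proof.
have [_ [g g0 [gg ag gu]]] := base; exists g => //; split.
  by split=> //; rewrite L0_energy (energy_grade gg) scale0r add0r.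
move=> v [av Lv]; apply: gu => //; apply: eigen_grade.
by move: Lv; rewrite L0_energy -[RHS]add0r scale0r => /addIr.
Qed.

Let z := (J + r.*2)%N.
Let M : set V := [set v | a 0 v = charge R z *: v /\ e 0 v = 0].

Lemma M_sub : subspace M.
Proof.
split=> [|c u v [u1 u2] [v1 v2]]; first by split; rewrite !linear0 ?scaler0.
split; rewrite linearP ?u1 ?v1 ?u2 ?v2 ?scaler0 ?addr0 //.
by rewrite scalerDr !scalerA mulrC.
Qed.

Lemma M_vir n v : M v -> M (L n v).
Proof.
move=> [v1 v2]; split; last by rewrite (comm_e0L Hirr g_neq0 e0sq) v2 vir_0.
by rewrite comm_aL v1 virZ scale0r addr0.
Qed.

Lemma vir_stable_D (W : set V) : subspace W -> (forall n v, W v -> W (L n v)) ->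
  forall v, W v -> W (D v).
Proof.
move=> sW WL v Wv; have /eqP := L0_energy v; rewrite -subr_eq => /eqP <-.
by apply: subspaceB => //; [exact: WL|exact: subspaceZ].
Qed.

Lemma vir_stable_component (W : set V) v : subspace W ->
  (forall n v, W v -> W (L n v)) -> W v ->
  exists (N : nat) (w : nat -> V), (forall n, grade H n (w n)) /\
    v = \sum_(n < N) w n /\ forall n, (n < N)%N -> W (w n).
Proof.
move=> sW WL Wv; have [N [w [gw vE]]] := grade_span H v.
exists N, w; split=> //; split=> //.
by apply: (graded_component sW (vir_stable_D sW WL)) => //; rewrite -vE.
Qed.

(** A nonzero vector of least degree in W is singular, so it is extremal by
    [singular_highest], and the extremal vectors of charge z / 2 form a line. *)
Lemma stable_extremal (W : set V) w : subspace W -> W `<=` M ->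
  (forall n v, W v -> W (L n v)) -> (exists2 v, W v & v != 0) ->
  extremal H z w -> w != 0 -> W w.
Proof.
move=> sW WM WL [v Wv v0] ew w0.
pose P n := `[< exists x, [/\ W x, x != 0 & grade H n x] >].
have exP : exists n, P n.
  have [N [y [gy [vE Wy]]]] := vir_stable_component sW WL Wv.
  apply: contrapT => /forallNP nP; case/eqP: v0; rewrite vE big1 // => n _.
  apply: contrapT => /eqP yn; apply: (nP n); apply/asboolP.
  by exists (y n); split=> //; exact: Wy.
have [n /asboolP[x [Wx x0 gx]] nmin] := ex_minnP exP.
have [ax ex] := WM _ Wx.
have x_sing : singular H x.
  move=> k k0; apply: contrapT => /eqP Lx0.
  have DL : D (L k x) = (n%:Z - k)%:~R *: L k x.
    by rewrite energy_vir (energy_grade gx) virZ -scalerBl intrB.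
  have [nk|kn] := ltP n%:Z k.
    case/eqP: Lx0; apply: (energy_eigen_lt0 (H := H) (c := (n%:Z - k)%:~R)) => //.
    by rewrite ltrz0 subr_lt0.
  have : P (n - `|k|)%N.
    apply/asboolP; exists (L k x); split=> //; first exact: WL.
    apply: eigen_grade; rewrite DL pmulrn; congr (_%:~R *: _); lia.
  by move/nmin; lia.
have sx : state H (charge R z) (n%:R + charge R J ^+ 2) x.
  by split=> //; rewrite L0_energy (energy_grade gx) scalerDl.
have hz : charge R z ^+ 2 = charge R J ^+ 2 + (J * r + r ^ 2)%:R.
  by rewrite /charge /z -muln2 !natrD !natrM; field.
(* The energy exceeds the square of the charge by a natural number. *)
have nN : (J * r + r ^ 2 <= n)%N.
  have := state_bound sx x0; rewrite hz.
  have -> : n%:R + charge R J ^+ 2 - (charge R J ^+ 2 + (J * r + r ^ 2)%:R) =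
            n%:R - (J * r + r ^ 2)%:R by ring.
  by rewrite subr_ge0 ler_nat.
have sxN : state H (charge R z) (charge R z ^+ 2 + (n - (J * r + r ^ 2))%:R) x.
  by move: sx; congr (state H _ _ _); rewrite hz natrB //; ring.
have N0 := singular_highest Hirr g_neq0 e0sq extremal_line_J sxN x_sing ex x0.
have ex' : extremal H z x by move: sxN; rewrite N0 addr0.
have [w' _ [_ w'u]] := extremal_line_add Hirr g_neq0 e0sq r extremal_line_J.
have [c xE] := w'u _ ex'; have [c' wE] := w'u _ ew.
have c0 : c != 0 by apply: contraNneq x0 => c0; rewrite xE c0 scale0r.
have -> : w = (c' / c) *: x by rewrite xE scalerA divfK.
exact: subspaceZ.
Qed.

(** The orthogonal complement W' of W in M is stable as well. If W and W' were
    both nonzero, then both would contain the extremal vector w, which would be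
    orthogonal to itself. The complement is large enough because the degrees are
    finite dimensional, so that each homogeneous u in M has a projection to W. *)
Lemma mult_space_irreducible : irreducible_on (range L) M.
Proof.
have [w w0 [ew _]] := extremal_line_add Hirr g_neq0 e0sq r extremal_line_J.
have Mw : M w by split; [exact: ew.1|exact: (extremal_e0 Hirr g_neq0 e0sq ew)].
split; first exact: M_sub.
- by move=> _ [n _ <-] v; exact: M_vir.
- by move=> M0; move: Mw; rewrite M0 => /= wE; rewrite wE eqxx in w0.
move=> W sW WM WS; have WL n v : W v -> W (L n v) by move=> Wv; apply: WS => //; exists n.
have [W0|] := pselect (forall v, W v -> v = 0).
  left; apply/seteqP; split=> v; first exact: W0.
  by move=> /= ->; exact: subspace_0.
move=> /existsNP[v0 /not_implyP[Wv0 /eqP v00]]; right.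
have Ww : W w by apply: (stable_extremal sW WM WL _ ew w0); exists v0.
apply/seteqP; split=> // u Mu.
have [N [y [gy [-> My]]]] := vir_stable_component M_sub M_vir Mu.
apply: (subspace_sum sW) => n _; have {My} My := My _ (ltn_ord n).
move: (nat_of_ord n) (gy n) My => k gk Mk; set t := y k in gk Mk *.
pose Wk := [set x | W x /\ grade H k x].
have sWk : subspace Wk.
  split=> [|c x1 x2 [? ?] [? ?]].
    by split; [exact: subspace_0|exact: (subspace_0 (grade_subspace H k))].
  by split; [exact: sW.2|exact: (grade_subspace H k).2].
have fWk : fin_dim Wk.
  have [d [s hs]] := grade_fin_dim H k; exists d, s => x [_ gx]; exact: hs.
have [x [[Wx gx] xo]] := ortho_proj H sWk fWk t.
have gd : grade H k (t - x) by apply: (subspaceB (grade_subspace H k)).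
pose W' := [set b | M b /\ forall c, W c -> '[c, b] = 0].
have sW' : subspace W'.
  split=> [|c b1 b2 [? h1] [? h2]].
    by split; [exact: (subspace_0 M_sub)|move=> *; exact: ip0r].
  split; first exact: M_sub.2.
  by move=> d Wd; rewrite ipDr ipZr h1 // h2 // mulr0 addr0.
have W'L n' b : W' b -> W' (L n' b).
  move=> [Mb h]; split; first exact: M_vir.
  by move=> c Wc; rewrite -[n']opprK -adj_L h //; exact: WL.
have W'd : W' (t - x).
  split; first by apply: (subspaceB M_sub) => //; exact: WM.
  move=> c Wc; have [N' [c' [gc [-> Wc']]]] := vir_stable_component sW WL Wc.
  rewrite linear_sumlz big1 // => l _ /=.
  have [lk|lk] := eqVneq (l : nat) k; last exact: grade_orthogonal lk (gc l) gd.
  by apply/ipC0/xo; split; [exact: Wc'|rewrite -lk].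
have [d0|d0] := eqVneq (t - x) 0.
  by move/eqP: d0; rewrite subr_eq0 => /eqP ->.
have W'w : W' w.
  apply: (stable_extremal sW' _ W'L _ ew w0); first by move=> b [].
  by exists (t - x).
by case/eqP: w0; apply: (ip_eq0 (H := H)); exact: W'w.2.
Qed.
End Main.

Theorem theoremA (R : realType) (V : lmodType R[i]) (H : level1_rep V)
    (j : rat) (hj : j = 0 \/ j = 1 / 2%:R)
    (H_irr : irreducible_rep H) (H_low : lowest_energy_space_is H j)
    (m : rat) (m_ge0 : 0 <= m) (m_j : m - j \is a Num.int) :
  irreducible_on (range (vir H)) (mult_space H m).
Proof.
have [J jE base] : exists2 J : nat, j = J%:R / 2%:R & (J <= 1)%N /\ lowest_line H J.
  case: hj H_low => ->; first by exists 0%N; [rewrite mul0r|split=> //; exact: lowest_line0].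
  by exists 1%N => //; split=> //; exact: lowest_line1.
have {base} [J1 base] := base.
have [r mE] : exists r : nat, m = j + r%:R.
  have /intrP[k kE] := m_j.
  have k0 : 0 <= k.
    rewrite leNgt; apply/negP => k0.
    have : m < 0.
      have -> : m = j + k%:~R by rewrite -kE subrKC.
      have k1 : (k%:~R : rat) <= -1 by rewrite (ler_int _ k (-1)); lia.
      have J1' : (J%:R : rat) <= 1 by rewrite (ler_nat _ J 1).
      by rewrite jE; lra.
    by rewrite ltNge m_ge0.
  by exists `|k|%N; rewrite pmulrn gez0_abs // -kE subrKC.
have mq : ratr m = charge R (J + r.*2) :> R[i].
  by rewrite mE jE rmorphD /= fmorph_div !ratr_nat /charge -muln2 natrD natrM; field.
rewrite /mult_space mq; exact: mult_space_irreducible.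
Qed.
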